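(* Let $G=(V,E)$ be the complete graph on $n$ vertices, and suppose that the edge weights $(X_e)_{e\in E}$ are independent random variables, where $X_e$ has a probability density function $f_e:[-1,1]\rightarrow [0,\phi]$ for some $\phi>0$. Then for every constant $\eta>0$, with probability $1-o(1)$ as $n\to\infty$, every implementation of the FLIP method for Max-3-Cut terminates in at most $O(\phi n^{99+\eta})$ steps.
   Context: A $3$-cut of $G$ is a partition of $V$ into $3$ parts; its value is the total weight of edges whose endpoints lie in different parts. The FLIP method for Max-3-Cut starts from an arbitrary $3$-cut and, as long as possible, moves a single vertex from its current part to one of the other two parts provided this strictly increases the cut value; it stops when no such move exists. An implementation specifies the initial $3$-cut, which vertex is moved at each step, and to which part; ''every implementation'' means the bound holds simultaneously for all such choices. *)

(* Defs.v *)
From HB Require Import structures.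
From mathcomp Require Import all_boot all_order all_algebra.
From mathcomp Require Import all_classical all_reals all_analysis.
Set Implicit Arguments.
Unset Strict Implicit.
Unset Printing Implicit Defensive.
Import Order.TTheory GRing.Theory Num.Theory.
Import numFieldNormedType.Exports.
Local Open Scope classical_set_scope.
Local Open Scope ring_scope.

Definition edge (n : nat) := {e : {set 'I_n} | #|e| == 2%N}.

(* The three parts are labelled by 'I_3 and may be empty: a FLIP move is
   allowed to empty a part or to repopulate an empty one. *)
Definition cut3 (n : nat) := {ffun 'I_n -> 'I_3}.

Definition crosses (n : nat) (s : cut3 n) (e : edge n) : bool :=
  [exists u in val e, exists v in val e, s u != s v].

Definition cut_value (R : realType) (n : nat) (w : edge n -> R) (s : cut3 n) : R :=
  \sum_(e : edge n | crosses s e) w e.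

Definition move (n : nat) (s : cut3 n) (v : 'I_n) (p : 'I_3) : cut3 n :=
  [ffun u => if u == v then p else s u].

Definition flip_step (R : realType) (n : nat) (w : edge n -> R) (s s' : cut3 n) : Prop :=
  exists v p, [/\ p != s v, s' = move s v p & cut_value w s < cut_value w s'].

Definition local_opt (R : realType) (n : nat) (w : edge n -> R) (s : cut3 n) : Prop :=
  forall s', ~ flip_step w s s'.

(* [c t] is the cut after [t] steps; once FLIP has stopped, the sequence is
   continued by a constant.  Nothing is assumed on how [c 0] and the moves are
   chosen, so the sequences [c] range over the behaviours of all
   implementations on the weights [w]. *)
Definition flip_execution (R : realType) (n : nat) (w : edge n -> R)
    (c : nat -> cut3 n) : Prop :=
  forall t, flip_step w (c t) (c t.+1) \/ (local_opt w (c t) /\ c t.+1 = c t).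

Definition flip_terminates_within (R : realType) (n : nat) (w : edge n -> R)
    (B : R) : Prop :=
  forall c, flip_execution w c -> exists2 t : nat, t%:R <= B & local_opt w (c t).

Definition mutually_independent (R : realType) (d : measure_display)
    (T : measurableType d) (P : probability T R) (I : finType)
    (X : I -> {RV P >-> R}) : Prop :=
  forall (J : {set I}) (A : I -> set R), (forall i, measurable (A i)) ->
    P (\bigcap_(i in [set` J]) (X i @^-1` A i)) =
    (\prod_(i in J) P (X i @^-1` A i))%E.

(* [f] is only looked at on [-1, 1]; the case [A = setT] of the last clause
   says that it integrates to 1 there. *)
Definition has_density_on_pm1 (R : realType) (d : measure_display)
    (T : measurableType d) (P : probability T R) (X : {RV P >-> R})
    (f : R -> R) : Prop :=
  [/\ measurable_fun (`[-1, 1]%classic : set R) f,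
      forall x, x \in `[-1, 1] -> 0 <= f x
    & forall A : set R, measurable A ->
        distribution P X A =
        (\int[lebesgue_measure]_(x in A `&` [set` `[-1, 1]%R]) (f x)%:E)%E].

(* Main.v *)
Require Import Defs.
From mathcomp Require Import all_boot all_order all_algebra.
From mathcomp Require Import zify ring lra.
Set Implicit Arguments.
Unset Strict Implicit.
Unset Printing Implicit Defensive.
Import Order.TTheory GRing.Theory Num.Theory.
Local Open Scope ring_scope.

(** Take a window of [4 n] improving moves and, in it, a shortest block whose
    length is at least 4 times its number [s] of moved vertices; its length is
    exactly [4 s], and every shorter block inside moves many vertices for its
    length. A vertex is heavy if it returns in the block to a part it had left.
    The gains along such a return add up to a linear form in the weights in
    which the non-moving vertices cancel, and this form is nonzero because the
    gains are positive; this gives [m / 2] independent forms for [m] heavy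
    vertices. A light vertex moves at most twice. If [m] is small, the heavy
    vertices make most of the moves, so that they are often interleaved with
    moves of light vertices. Among any three moves of a vertex some combination
    with coefficients in {-1, 0, 1} cancels all non-moving vertices, and among
    four moves of a heavy vertex separated by moves of light vertices one of
    these combinations involves the edge to a light vertex; here it matters
    that there are 3 parts. In both cases one gets at least [s / 24] independent
    integral forms. If the window gains less than [eps], all these forms are
    smaller than [eps] in absolute value, which has probability at most
    [(4 phi eps)^(s / 24)], against [(9 n)^(4 s)] sequences of moves: a union
    bound succeeds for [eps] of order [n^(-96-eta) / phi]. Hence a window of
    [4 n] moves gains [eps] out of a total range of [n^2]. *)

(** * Linear forms of a trace *)

Lemma pairwise_index (I : eqType) (s : seq I) :
  uniq s -> pairwise (fun i k => index i s < index k s)%N s.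
Proof.
case: s => // x0 s us; apply/(pairwiseP x0) => i j; rewrite !inE => hi hj ij.
by rewrite !index_uniq.
Qed.

Lemma pairwise_rev (I : Type) (r : rel I) (s : seq I) :
  pairwise r s -> pairwise (fun i k => r k i) (rev s).
Proof.
elim: s => // x s IH /andP[xs /IH sr]; rewrite rev_cons pairwise_rcons sr andbT.
by rewrite all_rev.
Qed.

(** Each [d i] is incident to [i] and to at most one other index of [S], which comes later ([up]) or
    earlier ([dn]) in a fixed enumeration. Listing the [up] indices backwards, or the [dn] indices
    forwards, leaves no incident index after [i]; the larger class has at least half of [S]. *)
Lemma triangular_half (I : finType) (J : Type) (S : {set I})
    (A : I -> J -> bool) (d : I -> J) :
  (forall i, i \in S -> A i (d i)) ->
  (forall i, i \in S -> #|[set k in S | A k (d i)]| <= 2)%N ->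
  exists l : seq I, [/\ {subset l <= S}, (#|S| <= 2 * size l)%N
                      & pairwise (fun i k => ~~ A k (d i)) l].
Proof.
move=> Ad A2; pose s := enum S; pose r i := index i s.
pose up := [pred i | [forall k in S, A k (d i) ==> (r i <= r k)%N]].
pose dn := [pred i | [forall k in S, A k (d i) ==> (r k <= r i)%N]].
have updn i : i \in S -> up i || dn i.
  move=> iS; rewrite -[up i]negbK -implybE; apply/implyP.
  rewrite negb_forall_in => /exists_inP[k kS]; rewrite negb_imply -ltnNge.
  move=> /andP[Ak ki]; apply/forall_inP => k' k'S; apply/implyP => Ak'.
  rewrite leqNgt; apply/negP => ik'.
  (* If [up] and [dn] both fail, then [i], [k] and [k'] are three indices incident to [d i]. *)
  have : (#|[set i; k; k']| <= #|[set k in S | A k (d i)]|)%N.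
    apply: subset_leq_card; apply/subsetP => j; rewrite !inE -orbA.
    by case/or3P => /eqP->; rewrite ?iS ?kS ?k'S ?Ad ?Ak ?Ak'.
  have neq a b : (r a < r b)%N -> a != b by apply: contraTneq => ->; rewrite ltnn.
  rewrite setUC cardsU1 cards2 !inE negb_or [k' == i]eq_sym [k' == k]eq_sym.
  rewrite neq // neq ?(ltn_trans ki) // [i == k]eq_sym neq //= => h.
  by have := leq_trans h (A2 i iS).
have szS : (#|S| <= size [seq i <- s | up i] + size [seq i <- s | dn i])%N.
  have -> : #|S| = count predT s by rewrite count_predT cardE.
  rewrite ![size [seq _ <- _ | _]]size_filter -count_predUI.
  apply: leq_trans (leq_addr _ _).
  by apply/eq_leq/eq_in_count => i; rewrite mem_enum => /updn /= ->.
have pw := pairwise_index (enum_uniq (mem S)).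
have sS p : all (mem S) [seq i <- s | p i].
  by apply/allP => i; rewrite mem_filter mem_enum => /andP[].
case: (leqP (size [seq i <- s | dn i]) (size [seq i <- s | up i])) => hle.
  exists (rev [seq i <- s | up i]); split.
  - by move=> i; rewrite mem_rev => /(allP (sS up)).
  - by rewrite size_rev; lia.
  - have := pairwise_rev (pairwise_filter up pw).
    apply: (@sub_in_pairwise _ [pred i | (i \in S) && up i]).
      move=> i k /andP[iS iu] /andP[kS ku] ik; apply/negP => Ak.
      by move/forall_inP: iu => /(_ k kS); rewrite Ak /= leqNgt ik.
    by apply/allP => i; rewrite mem_rev mem_filter mem_enum andbC.
exists [seq i <- s | dn i]; split.
- by move=> i /(allP (sS dn)).
- by lia.
- have := pairwise_filter dn pw.
  apply: (@sub_in_pairwise _ [pred i | (i \in S) && dn i]).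
    move=> i k /andP[iS iu] /andP[kS ku] ik; apply/negP => Ak.
    by move/forall_inP: iu => /(_ k kS); rewrite Ak /= leqNgt ik.
  by apply/allP => i; rewrite mem_filter mem_enum andbC.
Qed.

(** * Moves between three parts *)

(** With the parts read modulo 3, this is the change in the crossing status of the edge to a vertex
    in part [x] when the other endpoint moves from [a] to [a + 1]. Up to sign, every move has this
    form. *)
Definition h3 (a x : 'I_3) : int := (x == a)%:Z - (x == (a + 1)%R)%:Z.

Lemma h3_inj (a x y : 'I_3) : x != y -> h3 a x - h3 a y != 0.
Proof.
by case: a => [[|[|[|?]]] ?] //; case: x => [[|[|[|?]]] ?] //;
   case: y => [[|[|[|?]]] ?].
Qed.

Lemma h3_sign (p q : 'I_3) : p != q ->
  exists s a, (s == 1 \/ s == -1 :> int) /\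
    forall x : 'I_3, (x == p)%:Z - (x == q)%:Z = s * h3 a x.
Proof.
case: (boolP (q == p + 1)) => [/eqP-> _|h1 h2].
  by exists 1, p; split=> [|x]; [left|rewrite mul1r].
exists (-1), q; split=> [|x]; first by right.
have -> : p = q + 1.
  by apply/val_inj; move: p q h1 h2 => [[|[|[|?]]] ?] [[|[|[|?]]] ?].
by rewrite /h3 mulN1r opprB.
Qed.

(** Three distinct types run once around the cycle of parts, so the sum telescopes. *)
Lemma h3_sum (a b c x : 'I_3) : a != b -> a != c -> b != c ->
  h3 a x + h3 b x + h3 c x = 0.
Proof.
by case: a => [[|[|[|?]]] ?] //; case: b => [[|[|[|?]]] ?] //;
  case: c => [[|[|[|?]]] ?] //; case: x => [[|[|[|?]]] ?].
Qed.

(* A triple of pairwise distinct moves is blind to a letter only if that letter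
   visits all three parts (rotating the other way). *)
Lemma h3_blind (a b c x y z : 'I_3) : a != b -> a != c -> b != c ->
  h3 a x + h3 b y + h3 c z = 0 ->
  (x = y /\ y = z) \/ [/\ x != y, y != z & x != z].
Proof.
case: a => [[|[|[|?]]] ?] //; case: b => [[|[|[|?]]] ?] //;
  case: c => [[|[|[|?]]] ?] //; case: x => [[|[|[|?]]] ?] //;
  case: y => [[|[|[|?]]] ?] //; case: z => [[|[|[|?]]] ?] //= _ _ _ H;
  first [by left; split; apply/val_inj | by right | by []].
Qed.

(** Conditions met by the positions, at four times in order, of a vertex that never comes back to a
    part it has left. *)
Definition no_return (x0 x1 x2 x3 : 'I_3) :=
  [/\ x0 = x2 -> x0 = x1, x1 = x3 -> x1 = x2 & x0 = x3 -> x0 = x1].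

(** The [a0], ..., [a3] are the types of four moves of one vertex; [x], [y], [z] are the positions
    of vertices that move in the first, second and third gap. Two equal types cancel in a
    difference, three distinct ones in a sum. If the first three moves give nothing, they are of
    distinct types and [x] visits all three parts; unable to return, it stays put in the third gap,
    and then the last three moves succeed. *)
Lemma gap_relation (a0 a1 a2 a3 : 'I_3) (x0 x1 x2 x3 y0 y1 y2 y3 z0 z1 z2 z3 : 'I_3) :
  x0 != x1 -> y1 != y2 -> z2 != z3 ->
  no_return x0 x1 x2 x3 -> no_return y0 y1 y2 y3 ->
  exists m0 m1 m2 m3 : int,
    let f u0 u1 u2 u3 :=
      m0 * h3 a0 u0 + m1 * h3 a1 u1 + m2 * h3 a2 u2 + m3 * h3 a3 u3 in
    [/\ [/\ `|m0| <= 1, `|m1| <= 1, `|m2| <= 1 & `|m3| <= 1],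
      forall t, f t t t t = 0 &
      [\/ f x0 x1 x2 x3 != 0, f y0 y1 y2 y3 != 0 | f z0 z1 z2 z3 != 0]].
Proof.
move=> hx hy hz [hx02 hx13 hx03] [hy02 hy13 hy03].
case: (eqVneq a0 a1) => [e01|n01].
  exists 1, (-1), 0, 0; split=> [//|t|]; first by rewrite e01; ring.
  by constructor 1; rewrite !mul0r !addr0 mul1r mulN1r e01 h3_inj.
case: (eqVneq a0 a2) => [e02|n02].
  exists 1, 0, (-1), 0; split=> [//|t|]; first by rewrite e02; ring.
  constructor 1; rewrite !mul0r !addr0 mul1r mulN1r e02 h3_inj //.
  by apply: contra_neqN hx => /eqP /hx02.
case: (eqVneq a1 a2) => [e12|n12].
  exists 0, 1, (-1), 0; split=> [//|t|]; first by rewrite e12; ring.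
  by constructor 2; rewrite !mul0r !addr0 add0r mul1r mulN1r e12 h3_inj.
case: (eqVneq (h3 a0 x0 + h3 a1 x1 + h3 a2 x2) 0) => [/h3_blind|Hx]; last first.
  exists 1, 1, 1, 0; split=> [//|t|].
    by rewrite !mul1r mul0r addr0 h3_sum.
  by constructor 1; rewrite !mul1r mul0r addr0.
case=> // [[e _]|[_ x12 x02]]; first by rewrite e eqxx in hx.
(* All three parts are used up, so the last one cannot be left. *)
have x3E : x3 = x2.
  have [h1 h2] : x3 != x0 /\ x3 != x1.
    split; apply/eqP => e; first by move: hx; rewrite hx03 ?eqxx.
    by move: x12; rewrite hx13 ?eqxx.
  by apply/val_inj; move: x0 x1 x2 x3 hx x12 x02 h1 h2 {hx02 hx13 hx03} =>
    [[|[|[|?]]] ?] [[|[|[|?]]] ?] [[|[|[|?]]] ?] [[|[|[|?]]] ?].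
case: (eqVneq a1 a3) => [e13|n13].
  exists 0, 1, 0, (-1); split=> [//|t|]; first by rewrite e13; ring.
  constructor 2; rewrite !mul0r !addr0 add0r mul1r mulN1r e13 h3_inj //.
  by apply: contra_neqN hy => /eqP /hy13.
case: (eqVneq a2 a3) => [e23|n23].
  exists 0, 0, 1, (-1); split=> [//|t|]; first by rewrite e23; ring.
  by constructor 3; rewrite !mul0r !add0r mul1r mulN1r e23 h3_inj.
exists 0, 1, 1, 1; split=> [//|t|].
  by rewrite !mul1r mul0r add0r h3_sum.
constructor 1; rewrite !mul1r mul0r add0r x3E; apply/eqP.
case/h3_blind => // [[e _]|[_]]; first by rewrite e eqxx in x12.
by rewrite eqxx.
Qed.

(** * Combinations of gains as linear forms in the weights *)

Lemma crosses_pair (n : nat) (s : cut3 n) (e : edge n) (u w : 'I_n) :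
  u \in val e -> w \in val e -> u != w -> crosses s e = (s u != s w).
Proof.
move=> ue we uw; have ve : val e = [set u; w].
  apply/esym/eqP; rewrite eqEcard subUset !sub1set ue we.
  by rewrite (eqP (valP e)) cards2 uw.
rewrite /crosses ve; apply/exists_inP/idP => [[x]|h].
  rewrite !inE => /orP[] /eqP-> /exists_inP[y]; rewrite !inE => /orP[] /eqP->;
    by rewrite ?eqxx // eq_sym.
exists u; first by rewrite !inE eqxx.
by apply/exists_inP; exists w; rewrite // !inE eqxx orbT.
Qed.

Lemma crosses_local (n : nat) (s s' : cut3 n) (e : edge n) :
  {in val e, s =1 s'} -> crosses s e = crosses s' e.
Proof.
move=> h; rewrite /crosses; apply: eq_existsb => u; apply/andP/andP => -[ue];
  move=> /exists_inP[w we suw]; split=> //; apply/exists_inP; exists w => //.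
  by rewrite -!h.
by rewrite !h.
Qed.

Lemma edge_other (n : nat) (e : edge n) (x : 'I_n) : x \in val e ->
  exists2 u, u \in val e & u != x.
Proof.
move=> xe; have : (0 < #|val e :\ x|)%N.
  by have := cardsD1 x (val e); rewrite xe (eqP (valP e)) add1n => -[<-].
by case/card_gt0P => u; rewrite !inE => /andP[ux ue]; exists u.
Qed.

Lemma edge_pair (n : nat) (x u : 'I_n) : u != x ->
  exists e : edge n, x \in val e /\ u \in val e.
Proof.
move=> ux; have h : #|[set u; x]| == 2%N by rewrite cards2 ux.
by exists (Sub [set u; x] h); rewrite /= !inE !eqxx orbT.
Qed.

Lemma edge_mem2 (n : nat) (e : edge n) (x y z : 'I_n) : x != y ->
  x \in val e -> y \in val e -> z \in val e -> z = x \/ z = y.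
Proof.
move=> xy xe ye ze; have ve : val e = [set x; y].
  apply/esym/eqP; rewrite eqEcard subUset !sub1set xe ye.
  by rewrite (eqP (valP e)) cards2 xy.
by move: ze; rewrite ve !inE => /orP[] /eqP->; [left|right].
Qed.

(* [v t] is the vertex moved at time [t]. *)
Definition trace (n l : nat) (v : nat -> 'I_n) (c : nat -> cut3 n) : Prop :=
  forall t, (t < l)%N -> c t.+1 (v t) != c t (v t) /\
    forall u, u != v t -> c t.+1 u = c t u.

Definition move_delta (n : nat) (c : nat -> cut3 n) (t : nat) (e : edge n) : int :=
  (crosses (c t.+1) e)%:Z - (crosses (c t) e)%:Z.

Definition move_form (n l : nat) (c : nat -> cut3 n) (lam : nat -> int) (e : edge n) : int :=
  \sum_(0 <= t < l) lam t * move_delta c t e.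

(* The combination [lam] only involves moves of [x] and cancels the edges from
   [x] to the vertices that do not move. *)
Definition balanced (n l : nat) (v : nat -> 'I_n) (c : nat -> cut3 n)
    (x : 'I_n) (lam : nat -> int) : Prop :=
  (forall t, (t < l)%N -> lam t != 0 -> v t = x) /\
  forall z : 'I_3,
    \sum_(0 <= t < l) lam t * ((z == c t x)%:Z - (z == c t.+1 x)%:Z) = 0.

Section Trace.
Variables (n l : nat) (v : nat -> 'I_n) (c : nat -> cut3 n).
Hypothesis tr : trace l v c.

Lemma trace_const (u : 'I_n) (i j : nat) : (i <= j <= l)%N ->
  (forall t, (i <= t < j)%N -> v t != u) -> c j u = c i u.
Proof.
elim: j => [|j IH] /andP[ij jl] h; first by move: ij; rewrite leqn0 => /eqP->.
move: ij; rewrite leq_eqVlt => /predU1P[->//|ij].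
have [_ ->] := tr jl; last by rewrite eq_sym h // -ltnS ij ltnSn.
by apply: IH => [|t /andP[it tj]]; [rewrite -ltnS ij ltnW|apply: h; rewrite it ltnW].
Qed.

Lemma delta0 (t : nat) (e : edge n) : (t < l)%N -> v t \notin val e -> move_delta c t e = 0.
Proof.
move=> tl ve; rewrite /move_delta (@crosses_local _ (c t.+1) (c t)) ?subrr // => u ue.
by have [_ ->//] := tr tl; apply: contraNneq ve => <-.
Qed.

Lemma delta_pair (t : nat) (e : edge n) (x u : 'I_n) : x \in val e -> u \in val e ->
  u != x -> move_delta c t e =
    (c t u == c t x)%:Z - (c t.+1 u == c t.+1 x)%:Z.
Proof.
move=> xe ue ux; rewrite /move_delta !(crosses_pair _ ue xe ux).
by do 2![case: eqP => _].
Qed.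

Lemma form_notin (x : 'I_n) (lam : nat -> int) (e : edge n) :
  balanced l v c x lam -> x \notin val e -> move_form l c lam e = 0.
Proof.
move=> [h _] xe; rewrite /move_form big_nat big1 // => t /andP[_ tl].
by case: (eqVneq (lam t) 0) => [->|/(h _ tl) vt]; rewrite ?mul0r // delta0 ?mulr0 ?vt.
Qed.

Lemma form_pair (x u : 'I_n) (lam : nat -> int) (e : edge n) :
  balanced l v c x lam -> x \in val e -> u \in val e -> u != x ->
  move_form l c lam e =
  \sum_(0 <= t < l) lam t * ((c t u == c t x)%:Z - (c t u == c t.+1 x)%:Z).
Proof.
move=> [h _] xe ue ux; apply: eq_big_nat => t /andP[_ tl].
case: (eqVneq (lam t) 0) => [->|/(h _ tl) vt]; rewrite ?mul0r //.
by rewrite (delta_pair _ xe ue ux) (tr tl).2 // vt.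
Qed.

(** If [u] is in part [z] at every move used, the coefficient of the edge is the very sum that
    balance makes zero. *)
Lemma form_const (x u : 'I_n) (z : 'I_3) (lam : nat -> int) (e : edge n) :
  balanced l v c x lam -> x \in val e -> u \in val e -> u != x ->
  (forall t, (t < l)%N -> lam t != 0 -> c t u = z) -> move_form l c lam e = 0.
Proof.
move=> bal xe ue ux h; rewrite (form_pair bal xe ue ux) -[RHS](bal.2 z).
apply: eq_big_nat => t /andP[_ tl].
by case: (eqVneq (lam t) 0) => [->|/(h _ tl) ->]; rewrite ?mul0r.
Qed.

End Trace.

Lemma balanced_same (n l : nat) (v : nat -> 'I_n) (c c' : nat -> cut3 n)
    (x : 'I_n) (lam : nat -> int) :
  (forall t, (t < l)%N -> c t (v t) = c' t (v t) /\ c t.+1 (v t) = c' t.+1 (v t)) ->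
  balanced l v c x lam -> balanced l v c' x lam.
Proof.
move=> same [h1 h2]; split=> // z; rewrite -[RHS](h2 z).
apply: eq_big_nat => t /andP[_ tl]; have := same _ tl.
by case: (eqVneq (lam t) 0) => [->|/(h1 _ tl) ->]; rewrite ?mul0r // => -[-> ->].
Qed.

(** An endpoint that moves at some time has its whole itinerary fixed by the moves; an endpoint that
    never moves gives coefficient zero by balance. Hence a balanced form depends on the moves only,
    and the union bound need not range over initial cuts. *)
Lemma form_same (n l : nat) (v : nat -> 'I_n) (c c' : nat -> cut3 n)
    (x : 'I_n) (lam : nat -> int) (e : edge n) :
  trace l v c -> trace l v c' ->
  (forall t, (t < l)%N -> c t (v t) = c' t (v t) /\ c t.+1 (v t) = c' t.+1 (v t)) ->
  balanced l v c x lam -> move_form l c lam e = move_form l c' lam e.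
Proof.
move=> tr tr' same bal; have bal' := balanced_same same bal.
case: (boolP (x \in val e)) => [xe|xe]; last first.
  by rewrite (form_notin tr bal) // (form_notin tr' bal').
have [u ue ux] := edge_other xe.
case: (boolP (has (fun t => v t == u) (iota 0 l))) => [/hasP[s]|/hasPn nm].
  rewrite mem_iota add0n /= => sl /eqP vs.
  have agree t : (t <= l)%N -> c t u = c' t u.
    (* From the move of [u] at time [s] the two traces agree on [u] backwards to time 0, and then
       forwards from there. *)
    have down k : (k <= s)%N -> c (s - k)%N u = c' (s - k)%N u.
      elim: k => [|k IH] ks; first by rewrite subn0 -vs (same s sl).1.
      have kl : (s - k.+1 < l)%N by lia.
      case: (eqVneq u (v (s - k.+1)%N)) => [->|uv]; first exact: (same _ kl).1.
      rewrite -((tr _ kl).2 u uv) -((tr' _ kl).2 u uv).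
      by rewrite subnSK //; apply: IH; lia.
    elim: t => [|t IH] tl; first by have := down s (leqnn s); rewrite subnn.
    case: (eqVneq u (v t)) => [->|uv]; first exact: (same _ tl).2.
    by rewrite ((tr _ tl).2 u uv) ((tr' _ tl).2 u uv) IH // ltnW.
  rewrite (form_pair tr bal xe ue ux) (form_pair tr' bal' xe ue ux).
  apply: eq_big_nat => t /andP[_ tl].
  case: (eqVneq (lam t) 0) => [->|/(bal.1 _ tl) vt]; rewrite ?mul0r //.
  by have := same _ tl; rewrite vt => -[-> ->]; rewrite agree // ltnW.
have cst d t : trace l v d -> (t < l)%N -> d t u = d 0%N u.
  move=> trd tl; apply: (trace_const trd) => [|j]; first by rewrite leq0n ltnW.
  by move=> /andP[_ jt]; apply: nm; rewrite mem_iota add0n leq0n (ltn_trans jt).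
rewrite (@form_const _ _ _ _ tr x u (c 0%N u)) // => [|t tl _]; last exact: cst.
by rewrite (@form_const _ _ _ _ tr' x u (c' 0%N u)) // => t tl _; apply: cst.
Qed.

Lemma form_dot (R : pzRingType) (n l : nat) (c : nat -> cut3 n) (lam : nat -> int)
    (w : edge n -> R) :
  \sum_e w e * (move_form l c lam e)%:~R =
  \sum_(0 <= t < l) (lam t)%:~R * \sum_e w e * (move_delta c t e)%:~R.
Proof.
transitivity (\sum_e \sum_(0 <= t < l) (lam t)%:~R * (w e * (move_delta c t e)%:~R)).
  apply: eq_bigr => e _; rewrite /move_form rmorph_sum mulr_sumr; apply: eq_bigr => t _.
  by rewrite rmorphM /= !mulrA; congr (_ * _); rewrite commr_int.
by rewrite exchange_big; apply: eq_bigr => t _; rewrite mulr_sumr.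
Qed.

(** * Heavy and light vertices *)

Lemma sum_nat_pick (l r : nat) (G : nat -> int) : (r < l)%N ->
  \sum_(0 <= s < l) (s == r)%:Z * G s = G r.
Proof.
move=> rl; rewrite big_mkord (bigD1 (Ordinal rl)) //= eqxx mul1r big1 ?addr0 //.
by move=> i; rewrite -val_eqE /= => /negbTE->; rewrite mul0r.
Qed.

(* [x] returns during the trace to a part which it has left; otherwise it is
   light, and visits each part at most once. *)
Definition heavy (n l : nat) (v : nat -> 'I_n) (c : nat -> cut3 n) (x : 'I_n) : bool :=
  [exists t : 'I_l, [exists t' : 'I_l.+1, [&& (t < t')%N, v t == x & c t x == c t' x]]].

Section Heavy.
Variables (n l : nat) (v : nat -> 'I_n) (c : nat -> cut3 n).
Hypothesis tr : trace l v c.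
Local Notation heavy := (heavy l v c).

Lemma heavyP (x : 'I_n) :
  reflect (exists t t', [/\ (t < t' <= l)%N, v t = x & c t x = c t' x]) (heavy x).
Proof.
apply: (iffP existsP) => [[t /existsP[t' /and3P[tt' /eqP vt /eqP ct]]]|].
  by exists t, t'; split=> //; rewrite tt' -ltnS ltn_ord.
move=> [t [t' [/andP[tt' tl] vt ct]]].
exists (Ordinal (leq_trans tt' tl)); apply/existsP.
have tl1 : (t' < l.+1)%N by [].
by exists (Ordinal tl1); rewrite /= tt' vt ct !eqxx.
Qed.

(** The first move of [u] from time [i] on leaves the part [c i u]; being there again at time [j]
    would make [u] heavy. *)
Lemma light_visible (u : 'I_n) (i j t : nat) : ~~ heavy u -> (i <= t < j)%N ->
  (j <= l)%N -> v t = u -> c i u != c j u.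
Proof.
move=> lu itj jl vt.
have ex : exists s, (i <= s)%N && (v s == u).
  by exists t; rewrite vt eqxx andbT; lia.
case: (ex_minnP ex) => s /andP[is' /eqP vs] smin.
have st : (s <= t)%N by apply: smin; rewrite vt eqxx andbT; lia.
have -> : c i u = c s u.
  apply/esym; apply: (trace_const tr) => [|k /andP[ik ks]]; first by lia.
  by apply/eqP => vk; have := smin k; rewrite ik vk eqxx leqNgt ks => /(_ isT).
apply: contra lu => /eqP csj; apply/heavyP; exists s, j; split=> //; lia.
Qed.

Lemma light_still (u : 'I_n) (i k j : nat) : ~~ heavy u -> (i <= k <= j)%N ->
  (j <= l)%N -> c i u = c j u -> c i u = c k u.
Proof.
move=> lu ikj jl cij; apply/esym; apply: (trace_const tr) => [|t itk]; first by lia.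
apply/eqP => vt; have ij : (i <= t < j)%N by lia.
by have := light_visible lu ij jl vt; rewrite cij eqxx.
Qed.

(** The moves of a light vertex start from distinct parts, none of which is its final part; two
    parts remain. *)
Lemma light_moves (u : 'I_n) : ~~ heavy u -> (#|[set t : 'I_l | v t == u]| <= 2)%N.
Proof.
move=> lu; have inj : {in [set t : 'I_l | v t == u] &, injective (fun t : 'I_l => c t u)}.
  move=> s t; rewrite !inE => /eqP vs /eqP vt cst; apply: val_inj => /=.
  have neq (i j : 'I_l) : v i = u -> (i < j)%N -> c i u != c j u.
    by move=> vi ij; apply: (light_visible lu _ (ltnW (ltn_ord j)) vi); rewrite leqnn.
  case: (ltngtP s t) => // [/(neq _ _ vs)|/(neq _ _ vt)]; by rewrite cst eqxx.
rewrite -(card_in_imset inj).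
have le2 : (#|[set~ c l u]| <= 2)%N by rewrite cardsC1 card_ord.
apply: leq_trans le2; apply: subset_leq_card; apply/subsetP => p /imsetP[t]; rewrite !inE => /eqP vt ->.
by apply: (@light_visible u t l t); rewrite ?leqnn ?ltn_ord.
Qed.

(** The moves of [x] from leaving a part until being back there telescope, so their sum is balanced.
    Its value at [w] is a sum of positive gains, hence some coefficient is nonzero. *)
Lemma star_form (R : numDomainType) (w : edge n -> R) (x : 'I_n) :
  (forall t, (t < l)%N -> 0 < \sum_e w e * (move_delta c t e)%:~R) -> heavy x ->
  exists lam e, [/\ forall t, `|lam t| <= 1, balanced l v c x lam
    & move_form l c lam e != 0].
Proof.
move=> gain /heavyP[t [t' [/andP[tt' tl] vt ct]]].
pose lam s : int := ((t <= s < t')%N && (v s == x))%:Z; exists lam.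
have bal : balanced l v c x lam.
  split=> [s sl|z].
    by rewrite /lam; case: (eqVneq (v s) x) => // _; rewrite andbF eqxx.
  transitivity (\sum_(0 <= s < l | (t <= s < t')%N)
     ((z == c s x)%:Z - (z == c s.+1 x)%:Z)).
    rewrite [RHS]big_mkcond; apply: eq_big_nat => s /andP[_ sl]; rewrite /lam.
    case: (_ <= _ < _)%N; rewrite ?mul0r //=.
    by case: (eqVneq (v s) x) => [_|vs]; rewrite ?mul1r // (tr sl).2 ?subrr // eq_sym.
  transitivity (\sum_(t <= s < t') ((z == c s x)%:Z - (z == c s.+1 x)%:Z)).
    by rewrite [RHS](big_nat_widenl _ 0%N) // [RHS](big_nat_widen _ _ l).
  apply: oppr_inj; rewrite -sumrN oppr0.
  under eq_bigr do rewrite opprB.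
  by rewrite (telescope_sumr (fun s => (z == c s x)%:Z) (ltnW tt')) ct subrr.
case: (pickP (fun e => move_form l c lam e != 0)) => [e he|z].
  exists e; split=> // s; rewrite /lam.
  by case: (_ && _).
have : 0 < \sum_e w e * (move_form l c lam e)%:~R.
  rewrite form_dot big_mkord.
  have tl' : (t < l)%N := leq_trans tt' tl.
  rewrite (bigD1 (Ordinal tl')) //= ltr_wpDr //.
    by apply: sumr_ge0 => i _; rewrite mulr_ge0 ?ler0z ?(ltW (gain _ _)) //.
  by rewrite /lam leqnn tt' vt eqxx mulr1z mul1r; exact: gain.
rewrite big1 ?ltxx // => e _.
by move/negbFE/eqP: (z e) => ->; rewrite mulr0.
Qed.

(** [gap_relation] applies because a light vertex that moves in a gap is in different parts at the
    two ends of the gap. *)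
Lemma gap_form (x : 'I_n) (r0 r1 r2 r3 u0 u1 u2 : nat) :
  v r0 = x -> v r1 = x -> v r2 = x -> v r3 = x ->
  [&& r0 <= u0 < r1, r1 <= u1 < r2, r2 <= u2 < r3 & r3 < l]%N ->
  heavy x -> ~~ heavy (v u0) -> ~~ heavy (v u1) -> ~~ heavy (v u2) ->
  exists lam e u, [/\ forall t, `|lam t| <= 1,
     forall t, lam t != 0 -> (r0 <= t <= r3)%N,
     balanced l v c x lam, move_form l c lam e != 0
    & [/\ x \in val e, u \in val e & ~~ heavy u]].
Proof.
move=> vr0 vr1 vr2 vr3 /and4P[g0 g1 g2 rl] hx l0 l1 l2.
have sgn r : v r = x -> (r < l)%N -> exists s a, (s == 1 \/ s == -1 :> int) /\
    forall z : 'I_3, (z == c r x)%:Z - (z == c r.+1 x)%:Z = s * h3 a z.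
  by move=> vr lr; apply: h3_sign; rewrite -vr eq_sym; have [] := tr lr.
have [s0 [a0 [hs0 ha0]]] := sgn _ vr0 ltac:(lia).
have [s1 [a1 [hs1 ha1]]] := sgn _ vr1 ltac:(lia).
have [s2 [a2 [hs2 ha2]]] := sgn _ vr2 ltac:(lia).
have [s3 [a3 [hs3 ha3]]] := sgn _ vr3 ltac:(lia).
have sq s : s == 1 \/ s == -1 :> int -> s * s = 1 by case=> /eqP->.
have vis u i j t : ~~ heavy u -> v t = u -> (i <= t < j)%N -> (j < l)%N -> c i u != c j u.
  by move=> lu vt it jl; apply: (light_visible lu it (ltnW jl)).
have nr u : ~~ heavy u -> no_return (c r0 u) (c r1 u) (c r2 u) (c r3 u).
  move=> lu; split.
  - by apply: (light_still lu); lia.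
  - by apply: (light_still lu); lia.
  - by apply: (light_still lu); lia.
have [m0 [m1 [m2 [m3 /= [[b0 b1 b2 b3] rel vs]]]]] :=
  @gap_relation a0 a1 a2 a3 _ _ _ _ _ _ _ _ (c r0 (v u2)) (c r1 (v u2)) _ _
    (vis _ r0 r1 _ l0 erefl g0 ltac:(lia)) (vis _ r1 r2 _ l1 erefl g1 ltac:(lia))
    (vis _ r2 r3 _ l2 erefl g2 rl) (nr _ l0) (nr _ l1).
(* The sign of each move goes into its coefficient, where it squares to 1 against the sign given by
   [h3_sign]. *)
pose lam t : int := (t == r0)%:Z * (s0 * m0) + (t == r1)%:Z * (s1 * m1) +
   (t == r2)%:Z * (s2 * m2) + (t == r3)%:Z * (s3 * m3).
have lamG G : \sum_(0 <= t < l) lam t * G t =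
    s0 * m0 * G r0 + s1 * m1 * G r1 + s2 * m2 * G r2 + s3 * m3 * G r3.
  under eq_bigr => t _ do rewrite /lam !mulrDl -!mulrA.
  rewrite !big_split /= !(@sum_nat_pick _ _ (fun t => _ * (_ * G t))); [|lia..].
  by rewrite !mulrA.
have lamx t : lam t != 0 -> [\/ t = r0, t = r1, t = r2 | t = r3].
  rewrite /lam; case: (eqVneq t r0) => [->|_]; first by constructor 1.
  case: (eqVneq t r1) => [->|_]; first by constructor 2.
  case: (eqVneq t r2) => [->|_]; first by constructor 3.
  case: (eqVneq t r3) => [->|_]; first by constructor 4.
  by rewrite !mul0r !addr0 eqxx.
have bal : balanced l v c x lam.
  split=> [t _ /lamx[]->//|z]; rewrite lamG ha0 ha1 ha2 ha3 -[RHS](rel z).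
  by rewrite !mulrA ![_ * _ * s0]mulrAC ![_ * _ * s1]mulrAC ![_ * _ * s2]mulrAC
     ![_ * _ * s3]mulrAC !sq // !mul1r.
have lam1 t : `|lam t| <= 1.
  have nm s m : s == 1 \/ s == -1 :> int -> `|m| <= 1 -> `|s * m| <= 1.
    by move=> [] /eqP-> hm; rewrite ?mul1r // mulN1r normrN.
  case: (eqVneq (lam t) 0) => [->|/lamx]; first by rewrite normr0.
  rewrite /lam; case=> ->; rewrite eqxx.
  - have -> : (r0 == r1) = false by lia. have -> : (r0 == r2) = false by lia.
    have -> : (r0 == r3) = false by lia.
    by rewrite !mul0r !addr0 mul1r nm.
  - have -> : (r1 == r0) = false by lia. have -> : (r1 == r2) = false by lia.
    have -> : (r1 == r3) = false by lia.
    by rewrite !mul0r !addr0 add0r mul1r nm.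
  - have -> : (r2 == r0) = false by lia. have -> : (r2 == r1) = false by lia.
    have -> : (r2 == r3) = false by lia.
    by rewrite !mul0r !addr0 !add0r mul1r nm.
  - have -> : (r3 == r0) = false by lia. have -> : (r3 == r1) = false by lia.
    have -> : (r3 == r2) = false by lia.
    by rewrite !mul0r !add0r mul1r nm.
have fin u : ~~ heavy u -> m0 * h3 a0 (c r0 u) + m1 * h3 a1 (c r1 u) +
    m2 * h3 a2 (c r2 u) + m3 * h3 a3 (c r3 u) != 0 ->
  exists lam e u, [/\ forall t, `|lam t| <= 1,
     forall t, lam t != 0 -> (r0 <= t <= r3)%N,
     balanced l v c x lam, move_form l c lam e != 0
    & [/\ x \in val e, u \in val e & ~~ heavy u]].
  move=> lu nz; have ux : u != x by apply: contraNneq lu => ->.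
  have [e [xe ue]] := edge_pair ux.
  exists lam, e, u; split=> // [t /lamx[]->|]; [lia..|].
  rewrite (form_pair tr bal xe ue ux) lamG ha0 ha1 ha2 ha3.
  by rewrite !mulrA ![_ * _ * s0]mulrAC ![_ * _ * s1]mulrAC ![_ * _ * s2]mulrAC
     ![_ * _ * s3]mulrAC !sq // !mul1r.
by case: vs => /fin; apply.
Qed.
End Heavy.

(** * Rank of a critical block *)

Lemma card_ord_interval (l a b : nat) : (a <= b)%N ->
  (#|[set i : 'I_l | (a <= i <= b)%N]| <= (b - a).+1)%N.
Proof.
move=> ab; pose f (i : 'I_l) : 'I_(b - a).+1 := inord (i - a).
rewrite -(@card_in_imset _ _ f); first by rewrite -[leqRHS]card_ord max_card.
move=> i j; rewrite !inE => hi hj /(congr1 val); rewrite /= !inordK; try lia.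
by move=> e; apply: val_inj => /=; lia.
Qed.

Lemma card_fibers (I : finType) (P : pred I) (f : I -> nat) (N : nat) :
  (forall i, f i < N)%N ->
  #|[set i | P i]| = (\sum_(k < N) #|[set i | P i && (f i == k)]|)%N.
Proof.
move=> fN; rewrite -sum1_card (partition_big (fun i => Ordinal (fN i)) predT) //=.
by apply: eq_bigr => k _; rewrite -sum1_card; apply: eq_bigl => i; rewrite !inE.
Qed.

Section Blocks.
Variables (n l : nat) (v : nat -> 'I_n) (c : nat -> cut3 n).

(** A block of moves is read as a word over the vertices, of which this counts the distinct
    letters. *)
Definition letters (a m : nat) : nat :=
  #|[set x : 'I_n | has (fun i => v i == x) (iota a m)]|.

Hypothesis tr : trace l v c.
Hypothesis crit : forall a m, (a + m <= l)%N -> (m <= 4 * letters a m)%N.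
Local Notation heavy := (heavy l v c).

(** The counter is constant along a run of moves of heavy vertices and serves as a label of the
    run. *)
Definition nlight (t : nat) : nat := count (fun i => ~~ heavy (v i)) (iota 0 t).

(* The first move of its vertex since the last move of a light vertex. *)
Definition fresh (i : nat) : bool :=
  heavy (v i) &&
  all (fun k => ~~ ((v k == v i) && (nlight k == nlight i))) (iota 0 i).

Lemma nlight_cat (i j : nat) : (i <= j)%N ->
  nlight j = (nlight i + count (fun k => ~~ heavy (v k)) (iota i (j - i)))%N.
Proof. by move=> ij; rewrite /nlight -count_cat -{2}[i]add0n -iotaD subnKC. Qed.

Lemma nlight_mono (i j : nat) : (i <= j)%N -> (nlight i <= nlight j)%N.
Proof. by move=> /nlight_cat->; apply: leq_addr. Qed.

Lemma nlightS (i : nat) : nlight i.+1 = (nlight i + ~~ heavy (v i))%N.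
Proof. by rewrite (nlight_cat (leqnSn i)) subSnn /= addn0. Qed.

(** Heavy moves with a common label span a block of heavy moves only. By [crit] its length is at
    most 4 times its number of letters, and the first move of each letter under this label is
    fresh. *)
Lemma heavy_fresh :
  (#|[set i : 'I_l | heavy (v i)]| <= 4 * #|[set i : 'I_l | fresh i]|)%N.
Proof.
have bl (i : 'I_l) : (nlight i < l.+1)%N.
  by rewrite ltnS (leq_trans (count_size _ _)) // size_iota ltnW.
rewrite (card_fibers (fun i : 'I_l => heavy (v i)) bl).
rewrite (card_fibers (fun i : 'I_l => fresh i) bl) big_distrr /=.
apply: leq_sum => k _; set H := [set i : 'I_l | _].
have [->|[i iH]] := set_0Vmem H; first by rewrite cards0.
case: (@arg_minnP _ i (mem H) (@nat_of_ord l) iH) => i0 i0H i0min.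
case: (@arg_maxnP _ i (mem H) (@nat_of_ord l) iH) => i1 i1H i1max.
have i01 : (i0 <= i1)%N := i0min _ i1H.
move: (i0H) (i1H); rewrite !inE => /andP[_ /eqP b0] /andP[h1 /eqP b1].
have HI : (#|H| <= (i1 - i0).+1)%N.
  apply: leq_trans (card_ord_interval l i01); apply: subset_leq_card.
  apply/subsetP => j jH; rewrite inE; apply/andP; split.
    exact: i0min.
  exact: i1max.
apply: (leq_trans HI).
have il : (i0 + (i1 - i0).+1 <= l)%N by rewrite addnS subnKC.
apply: (leq_trans (crit il)); rewrite leq_mul2l /=.
apply: (@leq_trans #|[set v (val i) | i in [set i : 'I_l | fresh i && (nlight i == k)]]|);
  last exact: leq_imset_card.
apply: subset_leq_card; apply/subsetP => x; rewrite inE => /hasP[j].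
rewrite mem_iota addnS subnKC // ltnS => /andP[ij ji] /eqP vj.
have bj : nlight j = k.
  by apply/eqP; rewrite eqn_leq -{1}b1 -b0 !nlight_mono.
(* A light move before [i1] would raise the label. *)
have hj : heavy (v j).
  move: ji; rewrite leq_eqVlt => /predU1P[->//|ji].
  by have := nlight_mono ji; rewrite nlightS bj b1; case: (heavy (v j)) => //; lia.
have ex : exists j, (v j == x) && (nlight j == k) by exists j; rewrite vj bj !eqxx.
case: (ex_minnP ex) => j' /andP[/eqP vj' /eqP bj'] min.
have j'l : (j' < l)%N.
  apply: leq_ltn_trans (ltn_ord i1); apply: leq_trans ji.
  by apply: min; rewrite vj bj !eqxx.
apply/imsetP; exists (Ordinal j'l); rewrite ?inE //= bj' eqxx andbT.
rewrite /fresh vj' -vj hj; apply/allP => q; rewrite mem_iota add0n /= => qj.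
by apply/negP => qq; have := min q; rewrite -vj -bj' qq leqNgt qj => /(_ isT).
Qed.

Definition fresh_times (x : 'I_n) : seq nat :=
  [seq i <- iota 0 l | fresh i && (v i == x)].

Lemma fresh_nth (x : 'I_n) (k : nat) : (k < size (fresh_times x))%N ->
  let r := nth 0%N (fresh_times x) k in [/\ (r < l)%N, fresh r & v r = x].
Proof.
move=> /(mem_nth 0%N); rewrite mem_filter mem_iota add0n.
by move=> /andP[/andP[? /eqP ?] /andP[_ ?]].
Qed.

Lemma fresh_lt (x : 'I_n) (k k' : nat) : (k < k')%N -> (k' < size (fresh_times x))%N ->
  (nth 0 (fresh_times x) k < nth 0 (fresh_times x) k')%N.
Proof.
move=> kk' k's; apply: (sorted_ltn_nth ltn_trans) => //.
- by apply: sorted_filter; [exact: ltn_trans|exact: iota_ltn_sorted].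
- by rewrite inE (ltn_trans kk').
Qed.

Lemma fresh_gap (x : 'I_n) (k : nat) : (k.+1 < size (fresh_times x))%N ->
  exists2 t, (nth 0 (fresh_times x) k <= t < nth 0 (fresh_times x) k.+1)%N
           & ~~ heavy (v t).
Proof.
move=> ks; have lt := fresh_lt (ltnSn k) ks.
have [_ _ v1] := fresh_nth (ltnW ks); have [_ /andP[_ /allP f2] v2] := fresh_nth ks.
have := f2 (nth 0%N (fresh_times x) k); rewrite mem_iota add0n lt v1 v2 eqxx /=.
move=> /(_ isT) neq; have := nlight_cat (ltnW lt).
case: (boolP (has (fun i => ~~ heavy (v i)) (iota (nth 0 (fresh_times x) k)%N
   (nth 0 (fresh_times x) k.+1 - nth 0 (fresh_times x) k)))).
  by case/hasP => t; rewrite mem_iota subnKC ?(ltnW lt) // => ? ? _; exists t.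
by rewrite has_count -leqNgt leqn0 => /eqP-> /eqP; rewrite addn0 eq_sym (negbTE neq).
Qed.

Lemma size_fresh (x : 'I_n) : size (fresh_times x) = #|[set i : 'I_l | fresh i && (v i == x)]|.
Proof.
rewrite cardE size_filter -val_enum_ord count_map -size_filter /=.
rewrite enumT [in RHS]/enum_mem; congr size.
by apply: eq_filter => i; rewrite -[RHS]/(i \in [set _ | _]) in_set.
Qed.

Lemma card_lights : (#|[set i : 'I_l | ~~ heavy (v i)]| <=
  2 * #|[set x in [set x | has (fun i => v i == x) (iota 0 l)] | ~~ heavy x]|)%N.
Proof.
set U := [set x in _ | _]; rewrite -sum1_card.
rewrite (partition_big (fun i : 'I_l => v i) (mem U)) /=; last first.
  move=> i; rewrite !inE => li; rewrite li andbT; apply/hasP.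
  by exists (val i); rewrite ?mem_iota ?add0n ?ltn_ord ?eqxx.
rewrite -[leqRHS]/(2 * #|U|)%N mulnC -sum_nat_const; apply: leq_sum => x xU.
apply: leq_trans (light_moves tr (u := x) _); last by move: xU; rewrite inE => /andP[].
rewrite sum1_card; apply: subset_leq_card; apply/subsetP => i.
by rewrite !inE => /andP[].
Qed.

Lemma card_ord_ltn (q : nat) : (q <= l)%N -> #|[set j : 'I_l | (j < q)%N]| = q.
Proof.
move=> ql; have inj : injective (widen_ord ql) 
  by move=> i j /(congr1 val) /= /ord_inj.
rewrite -[RHS]card_ord -(card_imset predT inj).
apply: eq_card => j; rewrite inE; apply/idP/imsetP => [jq|[i _ ->//]].
  by exists (Ordinal jq) => //; apply: val_inj.
exact: (ltn_ord i).
Qed.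

(* The index [j] stands for the moves number [3j, ..., 3j+3] in [fresh_times x]. *)
Definition gaps : {set 'I_n * 'I_l} :=
  [set p : 'I_n * 'I_l | heavy p.1 && (3 * p.2 + 3 < size (fresh_times p.1))%N].

(** Neighbouring quadruples share a move, so [z] fresh moves of a vertex give [z.-1 %/ 3]
    quadruples, and [z] exceeds three times this number by at most 3. *)
Lemma card_gaps : (#|[set i : 'I_l | fresh i]| <=
  3 * #|gaps| + 3 * #|[set x | heavy x]|)%N.
Proof.
have -> : #|gaps| = (\sum_(x in [set x | heavy x])
    #|[set j : 'I_l | (3 * j + 3 < size (fresh_times x))%N]|)%N.
  rewrite -sum1_card.
  under [RHS]eq_bigr do rewrite -sum1_card.
  by rewrite pair_big_dep /=; apply: eq_bigl => p; rewrite !inE.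
have -> : #|[set i : 'I_l | fresh i]| =
    (\sum_(x in [set x | heavy x]) size (fresh_times x))%N.
  rewrite -sum1_card (partition_big (fun i : 'I_l => v i) (mem [set x | heavy x])) /=.
    apply: eq_bigr => x _; rewrite size_fresh -sum1_card.
    by apply: eq_bigl => i; rewrite !inE.
  by move=> i; rewrite !inE => /andP[].
rewrite [(3 * #|[set x | _]|)%N]mulnC -sum_nat_const big_distrr /= -big_split /=; apply: leq_sum => x _.
set z := size _; have zl : (z <= l)%N.
  by rewrite /z size_fresh -[leqRHS]card_ord max_card.
rewrite -[#|_|]/(#|[set j : 'I_l | (3 * j + 3 < z)%N]|).
have -> : [set j : 'I_l | (3 * j + 3 < z)%N] = [set j : 'I_l | (j < z.-1 %/ 3)%N].
  by apply/setP => j; rewrite !inE; apply/idP/idP; lia.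
rewrite card_ord_ltn; lia.
Qed.

Lemma gap_family (p : 'I_n * 'I_l) : p \in gaps ->
  exists q : (nat -> int) * edge n, [/\ forall t, `|q.1 t| <= 1,
     forall t, q.1 t != 0 -> (nth 0 (fresh_times p.1) (3 * p.2) <= t <=
                              nth 0 (fresh_times p.1) (3 * p.2 + 3))%N,
     balanced l v c p.1 q.1, move_form l c q.1 q.2 != 0
    & exists u, [/\ p.1 \in val q.2, u \in val q.2 & ~~ heavy u]].
Proof.
case: p => x j; rewrite inE /= => /andP[hx sz].
have [t0 ht0 l0] := @fresh_gap x (3 * j)%N ltac:(lia).
have [t1 ht1 l1] := @fresh_gap x (3 * j + 1)%N ltac:(lia).
have [t2 ht2 l2] := @fresh_gap x (3 * j + 2)%N ltac:(lia).
have [_ _ v0] := @fresh_nth x (3 * j)%N ltac:(lia).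
have [_ _ v1] := @fresh_nth x (3 * j + 1)%N ltac:(lia).
have [_ _ v2] := @fresh_nth x (3 * j + 2)%N ltac:(lia).
have [h3 _ v3] := @fresh_nth x (3 * j + 3)%N ltac:(lia).
rewrite -[(3 * j).+1]addn1 in ht0; rewrite -addnS in ht1; rewrite -addnS in ht2.
have h : [&& nth 0 (fresh_times x) (3 * j) <= t0 < nth 0 (fresh_times x) (3 * j + 1),
  nth 0 (fresh_times x) (3 * j + 1) <= t1 < nth 0 (fresh_times x) (3 * j + 2),
  nth 0 (fresh_times x) (3 * j + 2) <= t2 < nth 0 (fresh_times x) (3 * j + 3)
  & nth 0 (fresh_times x) (3 * j + 3) < l]%N by rewrite ht0 ht1 ht2 h3.
have [lam [e [u [? ? ? ? ?]]]] := gap_form tr v0 v1 v2 v3 h hx l0 l1 l2.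
by exists (lam, e); split=> //; exists u.
Qed.

(** * Families of forms in triangular position *)

(** The second component of a pair is a pivot edge. Triangularity in the pivots stands for linear
    independence and lets the probability estimate treat one weight at a time. *)
Definition good_family (L : seq ({ffun edge n -> int} * edge n)) : Prop :=
  (forall p : {ffun edge n -> int} * edge n, p \in L -> p.1 p.2 != 0 /\
     exists x lam, [/\ forall t, `|lam t| <= 1, balanced l v c x lam
                   & p.1 = [ffun e => move_form l c lam e]]) /\
  pairwise (fun p q : {ffun edge n -> int} * edge n => q.1 p.2 == 0) L.

Lemma triangular_family (I : finType) (S : {set I}) (g : I -> 'I_n)
    (lam : I -> nat -> int) (d : I -> edge n) :
  (forall i, i \in S -> [/\ forall t, `|lam i t| <= 1, balanced l v c (g i) (lam i)
                         & move_form l c (lam i) (d i) != 0]) ->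
  (forall i, i \in S ->
     #|[set k in S | move_form l c (lam k) (d i) != 0]| <= 2)%N ->
  exists2 L, good_family L & (#|S| <= 2 * size L)%N.
Proof.
move=> hS h2; have [|s [sS szS pw]] :=
  @triangular_half I (edge n) S (fun k e => move_form l c (lam k) e != 0) d _ h2.
  by move=> i /hS[].
exists [seq ([ffun e => move_form l c (lam i) e], d i) | i <- s]; last by rewrite size_map.
split=> [p /mapP[i /sS /hS[l1 bal nz] ->]|].
  by rewrite ffunE; split=> //; exists (g i), (lam i).
by rewrite pairwise_map; apply: sub_pairwise pw => i k /=; rewrite ffunE negbK.
Qed.

(** A form built from moves of [k] vanishes off the edges at [k], so only the forms of the two
    endpoints can be nonzero at a pivot. *)
Lemma star_family (R : numDomainType) (w : edge n -> R) :
  (forall t, (t < l)%N -> 0 < \sum_e w e * (move_delta c t e)%:~R) ->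
  exists2 L, good_family L & (#|[set x | heavy x]| <= 2 * size L)%N.
Proof.
move=> gain; have [S0|[x0 hx0]] := set_0Vmem [set x | heavy x].
  by rewrite S0 cards0; exists [::].
rewrite inE in hx0; have [_ [e0 _]] := star_form tr gain hx0.
have /fin_all_exists[q hq] (x : 'I_n) : exists q : (nat -> int) * edge n, heavy x ->
    [/\ forall t, `|q.1 t| <= 1, balanced l v c x q.1 & move_form l c q.1 q.2 != 0].
  case: (boolP (heavy x)) => [/(star_form tr gain)[lam [e h]]|]; first by exists (lam, e).
  by exists (fun=> 0, e0).
apply: (@triangular_family _ _ id (fun x => (q x).1) (fun x => (q x).2)).
  by move=> x; rewrite inE => /hq.
move=> x; rewrite inE => hx; rewrite -(eqP (valP (q x).2)).
apply: subset_leq_card; apply/subsetP => k; rewrite !inE => /andP[/hq[_ bal _]].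
by apply: contraNT => /(form_notin tr bal) ->.
Qed.

(** The pivot of [p] joins the heavy vertex [p.1] to a light vertex [u]. A form that is nonzero
    there belongs to the same heavy vertex, and [u] moves within its time range. The ranges for one
    heavy vertex are disjoint and [u] moves at most twice, so at most two forms qualify. *)
Lemma gap_rank : exists2 L, good_family L & (#|gaps| <= 2 * size L)%N.
Proof.
have [S0|[p0 hp0]] := set_0Vmem gaps; first by rewrite S0 cards0; exists [::].
have [q0 _] := gap_family hp0.
have /fin_all_exists[q hq] (p : 'I_n * 'I_l) : exists q : (nat -> int) * edge n,
    p \in gaps -> [/\ forall t, `|q.1 t| <= 1,
     forall t, q.1 t != 0 -> (nth 0 (fresh_times p.1) (3 * p.2) <= t <=
                              nth 0 (fresh_times p.1) (3 * p.2 + 3))%N,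
     balanced l v c p.1 q.1, move_form l c q.1 q.2 != 0
    & exists u, [/\ p.1 \in val q.2, u \in val q.2 & ~~ heavy u]].
  case: (boolP (p \in gaps)) => [/gap_family[q h]|_]; first by exists q.
  by exists q0.
apply: (@triangular_family _ _ fst (fun x => (q x).1) (fun x => (q x).2)).
  by move=> p /hq[].
move=> p pS; have [_ _ _ _ [u [pe ue lu]]] := hq p pS.
have ux y : heavy y -> u != y by apply: contraTneq => <-.
have hp1 : heavy p.1 by move: pS; rewrite inE => /andP[].
apply: leq_trans (light_moves tr lu).
pose lo (k : 'I_n * 'I_l) := nth 0%N (fresh_times k.1) (3 * k.2).
pose hi (k : 'I_n * 'I_l) := nth 0%N (fresh_times k.1) (3 * k.2 + 3).
set B := [set k in _ | _].
have Bp k : k \in B -> k.1 = p.1 /\ (3 * k.2 + 3 < size (fresh_times p.1))%N.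
  rewrite inE => /andP[kS nz]; have [_ _ bal _ _] := hq k kS.
  move: (kS); rewrite inE => /andP[hk sz].
  have ke : k.1 \in val (q p).2.
    by apply: contraNT nz => /(form_notin tr bal) ->.
  suff E : k.1 = p.1 by rewrite -E.
  have [ku|//] := edge_mem2 (ux _ hp1) ue pe ke.
    by case/negP: lu; rewrite -ku.
(* If [u] rested throughout the range of [k], balance would make the coefficient zero. *)
have mv k : k \in B -> exists t : 'I_l, v t = u /\ (lo k <= t < hi k)%N.
  move=> kB; have [kp ks] := Bp k kB; move: (kB); rewrite inE => /andP[kS nz].
  have [_ sup bal _ _] := hq k kS.
  have [hil _ _] := @fresh_nth k.1 (3 * k.2 + 3) ltac:(rewrite kp; lia).
  have lohi : (lo k < hi k)%N by apply: fresh_lt; rewrite ?kp //; lia.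
  case: (pickP (fun t : 'I_l => (v t == u) && (lo k <= t < hi k)%N)) => [t|none].
    by case/andP => /eqP; exists t.
  case/negP: nz; apply/eqP; apply: (@form_const _ _ _ _ tr k.1 u (c (lo k) u)) => //.
  - by rewrite kp.
  - by apply: ux; rewrite kp.
  - move=> t tl /sup /andP[lot thi]; apply: (trace_const tr) => [|i /andP[loi it]].
      by rewrite lot ltnW.
    have il : (i < l)%N := ltn_trans it tl.
    by have := none (Ordinal il); rewrite /= loi (leq_trans it thi) !andbT => /negbT.
have [k0|[k1 k1B]] := set_0Vmem B; first by rewrite k0 cards0.
have [t0 _] := mv _ k1B.
have /fin_all_exists[f hf] (k : 'I_n * 'I_l) : exists t : 'I_l, k \in B ->
    v t = u /\ (lo k <= t < hi k)%N.
  case: (boolP (k \in B)) => [/mv[t h]|_]; first by exists t.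
  by exists t0.
have inj : {in B &, injective f}.
  have lt k k' : k \in B -> k' \in B -> (k.2 < k'.2)%N -> (f k < f k')%N.
    move=> kB k'B kk'; have [_ /andP[_ h1]] := hf k kB.
    have [_ /andP[h2 _]] := hf k' k'B; apply: (leq_trans h1); apply: leq_trans h2.
    have [kp ks] := Bp k kB; have [kp' ks'] := Bp k' k'B; rewrite /lo /hi kp kp'.
    have : (3 * k.2 + 3 <= 3 * k'.2)%N by lia.
    rewrite leq_eqVlt => /predU1P[->//|h]; apply/ltnW/(fresh_lt h)/(leq_ltn_trans _ ks')/leq_addr.
  move=> k k' kB k'B fk; have [kp _] := Bp k kB; have [kp' _] := Bp k' k'B.
  case: (ltngtP k.2 k'.2) => [/(lt _ _ kB k'B)|/(lt _ _ k'B kB)|e].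
  - by rewrite fk ltnn.
  - by rewrite fk ltnn.
  - by move: kp kp' e; case: k k' {kB k'B fk} => a b [a' b'] /= -> -> /val_inj ->.
rewrite -(card_in_imset inj); apply: subset_leq_card; apply/subsetP => t.
by case/imsetP => k kB ->; rewrite inE; have [->] := hf k kB.
Qed.

Lemma critical_rank (R : numDomainType) (w : edge n -> R) :
  (forall t, (t < l)%N -> 0 < \sum_e w e * (move_delta c t e)%:~R) ->
  l = (4 * letters 0 l)%N ->
  exists2 L, good_family L & (letters 0 l <= 24 * size L)%N.
Proof.
move=> gain lE; have [L1 g1 s1] := star_family gain; have [L2 g2 s2] := gap_rank.
have cl : (#|[set i : 'I_l | heavy (v i)]| + #|[set i : 'I_l | ~~ heavy (v i)]| = l)%N.
  have := cardsC [set i : 'I_l | heavy (v i)]; rewrite card_ord.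
  by congr (_ + _ = _)%N; apply: eq_card => i; rewrite !inE.
have cx : (#|[set x in [set x | has (fun i => v i == x) (iota 0 l)] | ~~ heavy x]| +
    #|[set x | heavy x]| <= letters 0 l)%N.
  rewrite /letters -(cardsID [set x | heavy x] [set x | has _ _]) addnC leq_add //.
    apply: subset_leq_card; apply/subsetP => x; rewrite !inE => hx; rewrite hx andbT.
    move: hx => /heavyP[t [t' [tt' vt _]]]; apply/hasP; exists t; last by rewrite vt.
    by rewrite mem_iota; lia.
  by apply: subset_leq_card; apply/subsetP => x; rewrite !inE andbC.
have h1 := card_lights; have h2 := heavy_fresh; have h3 := card_gaps.
(* Let [m] be the number of heavy vertices and [s = letters 0 l]. If [s <= 12 m], the stars suffice.
   Otherwise there are at most [2 (s - m)] light moves, hence at least [2 (s + m)] heavy ones,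
   [(s + m) / 2] fresh ones and [(s - 5 m) / 6] gaps; half of the last number is at least
   [s / 24]. *)
case: (leqP (letters 0 l) (12 * #|[set x | heavy x]|)) => h.
  by exists L1 => //; lia.
by exists L2 => //; lia.
Qed.

End Blocks.

From mathcomp Require Import all_classical all_reals all_analysis.
From mathcomp Require Import measurable_realfun.
Import Order.TTheory GRing.Theory Num.Theory.
Import numFieldNormedType.Exports.
Local Open Scope ring_scope.

(** * Critical blocks and the gain of a window *)

Lemma letters_shift (n : nat) (v : nat -> 'I_n) (a b m : nat) :
  letters (fun t => v (a + t)%N) b m = letters v (a + b) m.
Proof.
by apply: eq_card => x; rewrite !inE iotaDl has_map.
Qed.

Lemma letters_leS (n : nat) (v : nat -> 'I_n) (a m : nat) :
  (letters v a m <= letters v a m.+1)%N.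
Proof.
apply: subset_leq_card; apply/fintype.subsetP => x; rewrite !inE.
by rewrite -(addn1 m) iotaD has_cat => ->.
Qed.

Lemma letters_gt0 (n : nat) (v : nat -> 'I_n) (a m : nat) : (0 < letters v a m.+1)%N.
Proof. by apply/card_gt0P; exists (v a); rewrite inE /= eqxx. Qed.

Lemma letters_le (n : nat) (v : nat -> 'I_n) (a m : nat) : (letters v a m <= n)%N.
Proof. by rewrite -[leqRHS]card_ord max_card. Qed.

(** The full window qualifies, having at most [n] letters. Dropping the last move of a shortest
    qualifying block leaves a block shorter than 4 times its number of letters, which forces
    equality. *)
Lemma exists_critical (n : nat) (v : nat -> 'I_n) : (0 < n)%N ->
  exists a s, [/\ (0 < s <= n)%N, (a + 4 * s <= 4 * n)%N, letters v a (4 * s) = s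
    & forall b m, (b + m <= 4 * s)%N -> (m <= 4 * letters v (a + b) m)%N].
Proof.
move=> n0.
pose P m := (0 < m)%N && [exists a : 'I_(4 * n).+1, (a + m <= 4 * n)%N
  && (4 * letters v a m <= m)%N].
have exP : exists m, P m.
  exists (4 * n)%N; rewrite /P muln_gt0 n0 /=; apply/existsP; exists ord0.
  by rewrite leqnn leq_mul2l letters_le.
case: (ex_minnP exP) => [[|m] /andP[// _ /existsP[a /andP[am lm]]] mmin].
have small b k : (b + k <= 4 * n)%N -> (0 < k < m.+1)%N -> (k < 4 * letters v b k)%N.
  case: k => // k bk km; rewrite ltnNge; apply/negP => h.
  have bl : (b < (4 * n).+1)%N by lia.
  suff /mmin : P k.+1 by rewrite leqNgt (andP km).2.
  by apply/existsP; exists (Ordinal bl); rewrite /= bk.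
have lE : (4 * letters v a m.+1)%N = m.+1.
  apply/eqP; rewrite eqn_leq lm /=; have := letters_gt0 v a m.
  have := letters_leS v a m; have := small a m; case: m {mmin exP} am lm small => [|m] am lm small; lia.
exists a, (letters v a m.+1); rewrite letters_gt0 letters_le lE; split=> // b k bk.
case: (posnP k) => [->//|k0].
case: (ltnP k m.+1) => [km|mk]; first by apply/ltnW/small; lia.
have [b0 kE] : b = 0%N /\ k = m.+1 by lia.
by rewrite b0 kE addn0 lE.
Qed.

(** The code [ms] stores the moved vertices with the parts they leave and enter, but not the cuts;
    there are [(9 n)^l] codes. *)
Definition realizes (n l : nat) (ms : {ffun 'I_l -> 'I_n * 'I_3 * 'I_3})
    (v : nat -> 'I_n) (c : nat -> cut3 n) : Prop :=
  trace l v c /\ forall t : 'I_l, ms t = (v t, c t (v t), c t.+1 (v t)).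

Definition critical (n l : nat) (v : nat -> 'I_n) : Prop :=
  l = (4 * letters v 0 l)%N /\
  forall a m, (a + m <= l)%N -> (m <= 4 * letters v a m)%N.

Definition triangular (n : nat) (L : seq ({ffun edge n -> int} * edge n)) : Prop :=
  (forall p : {ffun edge n -> int} * edge n, p \in L -> p.1 p.2 != 0) /\
  pairwise (fun p q : {ffun edge n -> int} * edge n => q.1 p.2 == 0) L.

(** The family must be fixed before the weights are known. It is taken from one realization of the
    moves, if there is any, and [form_same] carries it to all others. *)
Lemma moves_family (R : realType) (n l : nat) (ms : {ffun 'I_l -> 'I_n * 'I_3 * 'I_3}) :
  exists2 L, triangular L & forall (w : edge n -> R) v c,
    realizes ms v c -> critical l v ->
    (forall t, (t < l)%N -> 0 < \sum_e w e * (move_delta c t e)%:~R) ->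
    (l <= 96 * size L)%N /\
    forall p, p \in L -> `|\sum_e w e * (p.1 e)%:~R| <=
       \sum_(0 <= t < l) \sum_e w e * (move_delta c t e)%:~R.
Proof.
pose Q (w : edge n -> R) v c := [/\ realizes ms v c, critical l v &
  forall t, (t < l)%N -> 0 < \sum_e w e * (move_delta c t e)%:~R].
have [[w0 [v0 [c0 [[tr0 ms0] [l0 crit0] gain0]]]]|none] :=
    EM (exists w v c, Q w v c); last first.
  exists [::] => // w v c h1 h2 h3; case: none; by exists w, v, c.
have [L [hL pw] sz] := critical_rank tr0 crit0 gain0 l0.
exists L; first by split=> // p /hL[].
move=> w v c [tr msE] _ gain; split; first by lia.
have same t : (t < l)%N -> [/\ v0 t = v t, c0 t (v t) = c t (v t)
    & c0 t.+1 (v t) = c t.+1 (v t)].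
  by move=> tl; have := ms0 (Ordinal tl); rewrite msE /= => -[-> -> ->].
have tr' : trace l v0 c.
  by move=> t tl; have [-> _ _] := same t tl; apply: tr.
move=> p /hL[_ [x [lam [lam1 bal ->]]]].
under eq_bigr => e _.
  rewrite ffunE (@form_same _ _ v0 c0 c x lam e tr0 tr' _ bal); last first.
    by move=> t /same[-> -> ->].
  over.
rewrite form_dot; apply: le_trans (ler_norm_sum _ _ _) _.
rewrite big_nat [leRHS]big_nat; apply: ler_sum => t /andP[_ tl].
rewrite normrM (gtr0_norm (gain t tl)) ler_piMl ?(ltW (gain t tl)) //.
by rewrite -intr_norm -[leRHS]/(1%:~R) ler_int.
Qed.

Lemma cut_valueE (R : realType) (n : nat) (w : edge n -> R) (s : cut3 n) :
  cut_value w s = \sum_e w e * (crosses s e)%:R.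
Proof.
rewrite /cut_value big_mkcond; apply: eq_bigr => e _.
by case: crosses; rewrite ?mulr1 ?mulr0.
Qed.

Lemma cut_value_delta (R : realType) (n : nat) (w : edge n -> R)
    (c : nat -> cut3 n) (t : nat) :
  \sum_e w e * (move_delta c t e)%:~R = cut_value w (c t.+1) - cut_value w (c t).
Proof.
rewrite !cut_valueE -sumrB; apply: eq_bigr => e _.
by rewrite /move_delta rmorphB /= mulrBr.
Qed.

Lemma cut_value_bound (R : realType) (n : nat) (w : edge n -> R) (s s' : cut3 n) :
  (forall e, `|w e| <= 1) -> cut_value w s' - cut_value w s <= n%:R ^+ 2.
Proof.
move=> w1; rewrite !cut_valueE -sumrB.
apply: (@le_trans _ _ (\sum_(e : edge n) 1)).
  apply: ler_sum => e _; rewrite -mulrBr (le_trans (ler_norm _)) // normrM.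
  by rewrite mulr_ile1 //; do 2!case: crosses; rewrite ?subrr ?subr0 ?sub0r ?normrN ?normr0 ?normr1.
rewrite sumr_const -natrX ler_nat card_sig -cardsE.
have -> : #|[set x : {set 'I_n} | #|x| == 2%N]| = 'C(n, 2).
  by rewrite card_draws card_ord.
rewrite bin2; nia.
Qed.

(** The second hypothesis isolates the probabilistic input: in every large enough family some form
    is not small. This bounds from below the gain of a critical block of the window, and the other
    moves only add to it. *)
Lemma flip_gain (R : realType) (n : nat) (w : edge n -> R) (eps : R)
    (L : forall s, {ffun 'I_(4 * s) -> 'I_n * 'I_3 * 'I_3} ->
           seq ({ffun edge n -> int} * edge n)) :
  (forall s ms v c, realizes ms v c -> critical (4 * s) v ->
    (forall t, (t < 4 * s)%N -> 0 < \sum_e w e * (move_delta c t e)%:~R) ->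
    (4 * s <= 96 * size (L s ms))%N /\
    forall p, p \in L s ms -> `|\sum_e w e * (p.1 e)%:~R| <=
       \sum_(0 <= t < 4 * s) \sum_e w e * (move_delta c t e)%:~R) ->
  (forall s ms, (0 < s <= n)%N -> (s <= 24 * size (L s ms))%N ->
     exists2 p, p \in L s ms & eps <= `|\sum_e w e * (p.1 e)%:~R|) ->
  forall c, (0 < n)%N -> (forall t, (t < 4 * n)%N -> flip_step w (c t) (c t.+1)) ->
  cut_value w (c 0%N) + eps <= cut_value w (c (4 * n)%N).
Proof.
move=> fam good c n0 flips; pose x0 := Ordinal n0.
(* The moved vertex is recovered from the cuts; the default [x0] can only occur outside the
   window. *)
pose v t := odflt x0 [pick x | c t.+1 x != c t x].
have tr : trace (4 * n) v c.
  move=> t /flips[x [p [px cE _]]].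
  have cx u : u != x -> c t.+1 u = c t u by rewrite cE ffunE => /negbTE->.
  have vx : v t = x.
    rewrite /v; case: pickP => [y|/(_ x)] /=.
      by case: (eqVneq y x) => // /cx ->; rewrite eqxx.
    by rewrite cE ffunE eqxx px.
  by rewrite vx; split=> [|u]; [rewrite cE ffunE eqxx|exact: cx].
have gain t : (t < 4 * n)%N -> 0 < cut_value w (c t.+1) - cut_value w (c t).
  by move=> /flips[x [p [_ _]]]; rewrite subr_gt0.
have mono i j : (i <= j <= 4 * n)%N -> cut_value w (c i) <= cut_value w (c j).
  elim: j => [|j IH] /andP[ij jn]; first by move: ij; rewrite leqn0 => /eqP->.
  move: ij; rewrite leq_eqVlt => /predU1P[->//|ij].
  apply: (@le_trans _ _ (cut_value w (c j))); last by rewrite ltW // -subr_gt0 gain.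
  by apply: IH; rewrite -ltnS ij ltnW.
have [a [s [sn asn ls crit]]] := exists_critical v n0.
pose v' t := v (a + t)%N; pose c' t := c (a + t)%N.
pose ms : {ffun 'I_(4 * s) -> 'I_n * 'I_3 * 'I_3} :=
  [ffun t => (v' (val t), c' (val t) (v' (val t)), c' (val t).+1 (v' (val t)))].
have rms : realizes ms v' c'.
  split=> [t ts|t]; last by rewrite ffunE.
  by rewrite /v' /c' addnS; apply: tr; apply: leq_trans asn; rewrite -addnS leq_add2l.
have cr : critical (4 * s) v'.
  by split=> [|b m bm]; rewrite letters_shift ?addn0 ?ls ?crit.
have gain' t : (t < 4 * s)%N -> 0 < \sum_e w e * (move_delta c' t e)%:~R.
  move=> ts; rewrite cut_value_delta /c' addnS gain //.
  by apply: leq_trans asn; rewrite -addnS leq_add2l.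
have [sz lbd] := fam _ _ _ _ rms cr gain'.
have [|p pL hp] := good s ms sn; first by lia.
have := le_trans hp (lbd p pL).
under eq_bigr do rewrite cut_value_delta.
rewrite (telescope_sumr (fun t => cut_value w (c' t)) (leq0n _)) /c' addn0 => h.
rewrite -lerBrDl; apply: (le_trans h); apply: lerB; apply: mono.
  by rewrite asn leqnn.
by rewrite leq0n (leq_trans (leq_addr _ _) asn).
Qed.

(** Otherwise [K] consecutive windows would gain [K * eps], more than the range of the cut
    values. *)
Lemma flip_terminates (R : realType) (n : nat) (w : edge n -> R) (eps B : R) (K : nat) :
  (forall c, (forall t, (t < 4 * n)%N -> flip_step w (c t) (c t.+1)) ->
    cut_value w (c 0%N) + eps <= cut_value w (c (4 * n)%N)) ->
  (forall e, `|w e| <= 1) -> n%:R ^+ 2 < K%:R * eps -> (4 * n * K)%:R <= B ->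
  flip_terminates_within w B.
Proof.
move=> win w1 Keps KB c exc; apply: contrapT => no.
have nl t : (t <= 4 * n * K)%N -> ~ local_opt w (c t).
  by move=> tK lo; apply: no; exists t => //; apply: le_trans KB; rewrite ler_nat.
have fl t : (t < 4 * n * K)%N -> flip_step w (c t) (c t.+1).
  by move=> tK; case: (exc t) => // -[/nl]; rewrite ltnW //; case.
have inc k : (k <= K)%N -> cut_value w (c 0%N) + k%:R * eps <= cut_value w (c (4 * n * k)%N).
  elim: k => [|k IH] kK; first by rewrite mul0r addr0 muln0.
  have := win (fun t => c (4 * n * k + t)%N).
  rewrite addn0 -mulnSr => W; rewrite -natr1 mulrDl mul1r addrA.
  apply: le_trans (W _); first by rewrite lerD2r IH // ltnW.
  move=> t tn; rewrite addnS; apply: fl.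
  by rewrite (@leq_trans (4 * n * k.+1)%N) // ?leq_mul2l ?kK ?orbT // mulnSr -addnS leq_add2l.
have := cut_value_bound (c 0%N) (c (4 * n * K)%N) w1.
by move: (inc K (leqnn K)); lra.
Qed.

(** * Small values of independent forms *)

(** A nonzero integral slope is at least 1 in absolute value, so the solutions lie within a distance
    [2 * H] of each other. *)
Lemma card_ord_linear (R : realType) (N : nat) (a H : R) (c : int) :
  c != 0 -> 0 <= H ->
  (#|[set x : 'I_N | `|a + c%:~R * (val x)%:R| <= H]|)%:R <= 2 * H + 1.
Proof.
move=> c0 H0; set S := [set x | _].
have [->|[i iS]] := set_0Vmem S; first by rewrite cards0; lra.
case: (@arg_minnP _ i (mem S) (@nat_of_ord N) iS) => i0 i0S i0min.
case: (@arg_maxnP _ i (mem S) (@nat_of_ord N) iS) => i1 i1S i1max.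
have i01 : (i0 <= i1)%N := i0min _ i1S.
have SI : (#|S| <= (i1 - i0).+1)%N.
  apply: leq_trans (card_ord_interval N i01); apply: subset_leq_card.
  apply/fintype.subsetP => j jH; rewrite inE; apply/andP; split.
    exact: i0min.
  exact: i1max.
apply: (@le_trans _ _ (i1 - i0).+1%:R); first by rewrite ler_nat.
rewrite -natr1 lerD2r natrB //.
have c1 : 1 <= `|c%:~R : R| by rewrite -intr_norm ler1z; lia.
move: i0S i1S; rewrite !inE => h0 h1.
have := le_trans (ler_normB _ _) (lerD h1 h0).
rewrite opprD addrACA subrr add0r -mulrBr normrM.
rewrite (ger0_norm (_ : 0 <= i1%:R - i0%:R :> R)) ?subr_ge0 ?ler_nat // => h.
apply: (@le_trans _ _ (`|c%:~R| * (i1%:R - i0%:R))); last by lra.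
by rewrite ler_peMl // subr_ge0 ler_nat.
Qed.

Section FiniteProduct.
Variables (R : realType) (E : finType) (N : nat) (p : E -> 'I_N.+1 -> R).
Hypothesis p_ge0 : forall e x, 0 <= p e x.
Hypothesis p_sum : forall e, \sum_x p e x = 1.

(** The product measure with marginals [p e] on a finite grid. *)
Definition prod_prob (g : pred {ffun E -> 'I_N.+1}) : R :=
  \sum_(k | g k) \prod_e p e (k e).

Definition upd (k : {ffun E -> 'I_N.+1}) (e : E) (x : 'I_N.+1) :
  {ffun E -> 'I_N.+1} := [ffun e' => if e' == e then x else k e'].

(** Coordinate [e] is summed first; the points with [k e == ord0] represent the choices of the other
    coordinates. *)
Lemma prod_prob_upd (e : E) (g : pred {ffun E -> 'I_N.+1}) :
  prod_prob g = \sum_(k : {ffun E -> 'I_N.+1} | k e == ord0)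
    (\prod_(e' | e' != e) p e' (k e')) * \sum_(x | g (upd k e x)) p e x.
Proof.
rewrite /prod_prob (partition_big (fun k => upd k e ord0) (fun k => k e == ord0)) /=.
  apply: eq_bigr => k ke0; rewrite mulr_sumr.
  rewrite (reindex_onto (upd k e) (fun k' => k' e)); last first.
    move=> k' /andP[_ /eqP kE]; apply/ffunP => e'; rewrite ffunE.
    by case: (eqVneq e' e) => [->//|ee']; rewrite -kE ffunE (negbTE ee').
  apply: eq_big => x.
    rewrite [upd _ _ _ e]ffunE !eqxx andbT.
    have -> : upd (upd k e x) e ord0 == k; last by rewrite andbT.
    apply/eqP/ffunP => e'; rewrite !ffunE.
    by case: (eqVneq e' e) => [->|//]; rewrite (eqP ke0).
  move=> _; rewrite (bigD1 e) //= ffunE eqxx mulrC; congr (_ * _).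
  by apply: eq_bigr => e' /negbTE ee'; rewrite ffunE ee'.
by move=> k _; rewrite ffunE eqxx.
Qed.

Lemma prod_prob_step (e : E) (g1 g2 : pred {ffun E -> 'I_N.+1}) (b : R) :
  (forall k x, g1 (upd k e x) = g1 k) ->
  (forall k, \sum_(x | g2 (upd k e x)) p e x <= b) ->
  prod_prob (fun k => g1 k && g2 k) <= b * prod_prob g1.
Proof.
move=> h1 h2; rewrite !(prod_prob_upd e) mulr_sumr; apply: ler_sum => k _.
rewrite mulrCA ler_wpM2l ?prodr_ge0 //.
under eq_bigl do rewrite h1; under [X in _ <= _ * X]eq_bigl do rewrite h1.
case: (g1 k); first by rewrite p_sum mulr1; exact: h2.
by rewrite !big_pred0 ?mulr0.
Qed.

Lemma prod_probT : prod_prob predT = 1.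
Proof. by rewrite /prod_prob -bigA_distr_bigA big1. Qed.

(** The forms after the first do not involve its pivot coordinate. With the other coordinates fixed,
    the first form is affine in this coordinate with nonzero integral slope, so it is small for at
    most [2 * H + 1] values, each of mass at most [b]. *)
Lemma prod_prob_triangular (a : E -> R) (H b : R) (L : seq ({ffun E -> int} * E)) :
  (forall e x, p e x <= b) -> 0 <= H ->
  (forall q : {ffun E -> int} * E, q \in L -> q.1 q.2 != 0) ->
  pairwise (fun q q' : {ffun E -> int} * E => q'.1 q.2 == 0) L ->
  prod_prob (fun k => all (fun q : {ffun E -> int} * E =>
    `|\sum_e ((val (k e))%:R - a e) * (q.1 e)%:~R| <= H) L)
  <= ((2 * H + 1) * b) ^+ size L.
Proof.
move=> pb H0; elim: L => [|q L IH] nz /=.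
  by rewrite (_ : prod_prob _ = 1) ?expr0 // -prod_probT.
case/andP=> /allP qL pw.
have IH' : _ := IH _ pw; rewrite exprS.
have bge0 : 0 <= b := le_trans (p_ge0 q.2 ord0) (pb _ _).
have b0 : 0 <= (2 * H + 1) * b by rewrite mulr_ge0 // addr_ge0 // mulr_ge0.
apply: le_trans (ler_wpM2l b0 (IH' _)); last by move=> r rL; apply: nz; rewrite inE rL orbT.
under [prod_prob _]eq_bigl do rewrite andbC.
apply: (@prod_prob_step q.2) => [k x|k].
  apply: eq_in_all => r rL; congr (`|_| <= H); apply: eq_bigr => e _; rewrite ffunE.
  by case: eqP => // ->; rewrite (eqP (qL r rL)) !mulr0.
apply: (@le_trans _ _ (\sum_(x | `|\sum_e ((val (upd k q.2 x e))%:R - a e) * (q.1 e)%:~R| <= H) b)).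
  by apply: ler_sum.
rewrite sumr_const -[b *+ _]mulr_natl ler_wpM2r //.
have q0 : q.1 q.2 != 0 by apply: nz; rewrite inE eqxx.
pose A := \sum_(e | e != q.2) ((val (k e))%:R - a e) * (q.1 e)%:~R - a q.2 * (q.1 q.2)%:~R.
apply: le_trans (card_ord_linear N.+1 A q0 H0); rewrite ler_nat.
apply: subset_leq_card; apply/fintype.subsetP => x; rewrite unfold_in /= => h.
rewrite inE; suff <- : \sum_e ((upd k q.2 x e)%:R - a e) * (q.1 e)%:~R =
  A + (q.1 q.2)%:~R * x%:R by [].
rewrite (bigD1 q.2) //= ffunE eqxx /A.
under eq_bigr => e /negbTE eq do rewrite ffunE eq.
by ring.
Qed.

End FiniteProduct.

Local Open Scope classical_set_scope.
Local Open Scope ring_scope.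

(** * Densities and rounding of the weights *)

Lemma measure_union_bound (d : measure_display) (T : measurableType d) (R : realType)
    (P : probability T R) (I : finType) (Q : pred I) (A : I -> set T) (B : set T) :
  measurable B -> (forall i, measurable (A i)) ->
  (forall t, B t -> exists2 i, Q i & A i t) ->
  (P B <= \sum_(i | Q i) P (A i))%E.
Proof.
move=> mB mA BA.
have [mU PU] : measurable (\big[setU/set0]_(i | Q i) A i)%classic /\
    (P (\big[setU/set0]_(i | Q i) A i)%classic <= \sum_(i | Q i) P (A i))%E.
  elim/big_rec2 : _ => [|i y1 y2 Qi [my1 h]]; first by rewrite measure0.
  split; first exact: measurableU.
  by apply: (le_trans (@measureU2 _ _ _ P _ _ (mA i) my1)); apply: leeD.
apply: le_trans PU; apply: le_measure; rewrite ?inE // => t /BA[i Qi Ai].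
by rewrite (bigD1 i) //=; left.
Qed.

Section Density.
Variables (R : realType) (d : measure_display) (T : measurableType d).
Variables (P : probability T R) (X : {RV P >-> R}) (f : R -> R) (phi : R).
Hypothesis Xf : has_density_on_pm1 X f.
Hypothesis f_le : forall x, x \in `[-1, 1] -> f x <= phi.

Lemma density_interval (a b : R) : a <= b ->
  (P (X @^-1` [set` `[a, b[]) <= (phi * (b - a))%:E)%E.
Proof.
case: Xf => mf f0 /(_ [set` `[a, b[] (measurable_itv _)); rewrite /distribution.
rewrite /pushforward => -> ab; set D := (_ `&` _)%classic.
have mD : measurable D by apply: measurableI.
have phi0 : 0 <= phi.
  by apply: le_trans (f0 0 _) (f_le _); rewrite in_itv /= ?lerN10 ?ler01.
apply: (@le_trans _ _ (\int[lebesgue_measure]_(x in D) (cst phi%:E) x)%E).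
  apply: ge0_le_integral => //.
  - by move=> x [_ xI]; rewrite lee_fin f0.
  - apply/measurable_EFinP; apply: measurable_funS mf; first exact: measurable_itv.
    by move=> x [].
  - by move=> x [_ xI]; rewrite lee_fin f_le.
rewrite integral_cst // EFinM lee_wpmul2l ?lee_fin //.
apply: (@le_trans _ _ (lebesgue_measure [set` `[a, b[])).
  by apply: le_measure; rewrite ?inE // => x [].
rewrite lebesgue_measure_itv /= lte_fin.
by case: ifP => // _; rewrite lee_fin subr_ge0.
Qed.

Lemma density_support : P (X @^-1` [set` `[-1, 1]]) = 1%E.
Proof.
case: Xf => _ _ h.
have := h [set` `[-1, 1]] (measurable_itv _); have := h setT measurableT.
rewrite /distribution /pushforward setTI setIid preimage_setT probability_setT.
by move=> <-.
Qed.

(* The [x] for which [M * (x + 1)] rounds down to [k]. *)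
Definition cell (M k : nat) : set R :=
  [set` `[k%:R / M%:R - 1, k.+1%:R / M%:R - 1[].

Lemma cellP (M k : nat) (x : R) : (0 < M)%N ->
  cell M k x <-> k%:R <= M%:R * (x + 1) < k.+1%:R.
Proof.
move=> M0; rewrite /cell /= in_itv /= lerBlDr ltrBrDr.
by rewrite ler_pdivrMr ?ltr_pdivlMr ?ltr0n // mulrC.
Qed.

Lemma measurable_cell (M k : nat) : measurable (cell M k).
Proof. exact: measurable_itv. Qed.

(** The index [2 * M] is reached at [x = 1], hence the [2 * M + 1] cells. *)
Lemma cell_cover (M : nat) (x : R) : (0 < M)%N -> `|x| <= 1 ->
  exists k : 'I_(2 * M).+1, cell M k x.
Proof.
move=> M0; rewrite ler_norml => /andP[x0 x1].
have M0' : (0 : R) < M%:R by rewrite ltr0n.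
have Mx : 0 <= M%:R * (x + 1) by rewrite mulr_ge0 ?(ltW M0') //; lra.
have h := truncn_itv Mx.
have kM : (Num.trunc (M%:R * (x + 1)) < (2 * M).+1)%N.
  rewrite ltnS -(ler_nat R) (le_trans (andP h).1) // natrM mulrC ler_wpM2r //; lra.
by exists (Ordinal kM); apply/cellP.
Qed.

Lemma cell_prob (M k : nat) : (0 < M)%N ->
  (P (X @^-1` cell M k) <= (phi / M%:R)%:E)%E.
Proof.
move=> M0; apply: le_trans (density_interval _) _.
  by rewrite lerB // ler_wpM2r ?invr_ge0 ?ler0n // ler_nat.
rewrite lee_fin -natr1; suff -> : (k%:R + 1) / M%:R - 1 - (k%:R / M%:R - 1) = M%:R^-1 :> R.
  by [].
by field; rewrite pnatr_eq0 -lt0n.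
Qed.

Lemma cell_sum (M : nat) : (0 < M)%N ->
  (\sum_(k < (2 * M).+1) P (X @^-1` cell M k) = 1)%E.
Proof.
move=> M0; pose F k := X @^-1` cell M k.
have mF k : measurable (F k) by apply: measurable_funPTI; apply: measurable_cell.
have tF : trivIset setT F.
  apply/trivIsetP => i j _ _ ij; rewrite -subset0 => t [/(cellP _ _ M0) hi /(cellP _ _ M0) hj].
  by move/eqP: ij; apply; rewrite -(truncn_def hi) -(truncn_def hj).
have := @measure_bigsetU _ _ _ P F mF tF (2 * M).+1; rewrite -/(F _) => <-.
have mU : measurable (\big[setU/set0]_(i < (2 * M).+1) F i) by apply: bigsetU_measurable.
apply/eqP; rewrite eq_le probability_le1 //= -density_support; apply: le_measure.
- by rewrite inE; exact: measurable_funPTI.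
- by rewrite inE.
move=> t; rewrite /= in_itv /= -ler_norml => /(cell_cover M0)[k kX].
by rewrite (bigD1 k) //=; left.
Qed.

End Density.

Section Weights.
Variables (R : realType) (n : nat) (d : measure_display) (T : measurableType d).
Variables (P : probability T R) (X : edge n -> {RV P >-> R}) (f : edge n -> R -> R).
Variable phi : R.
Hypothesis phi_gt0 : 0 < phi.
Hypothesis Xindep : mutually_independent X.
Hypothesis Xf : forall e, has_density_on_pm1 (X e) (f e).
Hypothesis f_le : forall e x, x \in `[-1, 1] -> f e x <= phi.

(* Rounding every weight to a cell of width [1 / M] turns the event into a
   finite union of products of one-dimensional events, up to an error [S]
   which is negligible for large [M]. *)
Lemma forms_prob (L : seq ({ffun edge n -> int} * edge n)) (eps : R) :
  triangular L -> 0 < eps ->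
  exists A : set T, [/\ measurable A, (P A <= ((4 * phi * eps) ^+ size L)%:E)%E
    & forall t, (forall e, `|X e t| <= 1) ->
       (forall p, p \in L -> `|\sum_e X e t * (p.1 e)%:~R| < eps) -> A t].
Proof.
move=> [nz pw] eps0.
pose S : R := \sum_(p <- L) \sum_e `|(p.1 e)%:~R|.
have S0 : 0 <= S by apply: sumr_ge0 => p _; apply: sumr_ge0.
(* This [M] is large enough for [2 * H + 1 <= 4 * M * eps], with [H] as below. Since a cell has mass
   at most [phi / M], each form contributes a factor of at most [4 * phi * eps]. *)
pose M := (Num.trunc ((2 * S + 1) / (2 * eps))).+1.
have MP : (2 * S + 1) / (2 * eps) < M%:R := truncnS_gt _.
have M0 : (0 < M)%N by [].
have M0' : (0 : R) < M%:R by rewrite ltr0n.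
(* After scaling by [M], rounding shifts each weight by at most 1 and hence each form by at most
   [S]. *)
pose H := M%:R * eps + S.
have H0 : 0 <= H by rewrite addr_ge0 // mulr_ge0 // ltW.
pose N := (2 * M)%N.
pose C e (k : 'I_N.+1) := X e @^-1` cell M k.
have mC e k : measurable (C e k) by apply: measurable_funPTI; apply: measurable_cell.
pose p e k := fine (P (C e k)).
have pE e k : P (C e k) = (p e k)%:E by rewrite fineK // fin_num_measure.
have p_ge0 e k : 0 <= p e k by rewrite fine_ge0.
have p_sum e : \sum_k p e k = 1.
  have := cell_sum (Xf e) M0; under eq_bigr do rewrite -/(C e _) pE.
  by rewrite sumEFin => -[].
have p_le e k : p e k <= phi / M%:R.
  by rewrite -lee_fin -pE; apply: (cell_prob (Xf e) (f_le e)).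
pose good (k : {ffun edge n -> 'I_N.+1}) := all (fun q : {ffun edge n -> int} * edge n =>
   `|\sum_e ((val (k e))%:R - M%:R) * (q.1 e)%:~R| <= H) L.
pose D (k : {ffun edge n -> 'I_N.+1}) := \bigcap_(e in [set` [set: edge n]%SET]) C e (k e).
have mD k : measurable (D k) by apply: fin_bigcap_measurable.
have PD k : P (D k) = (\prod_e p e (k e))%:E.
  rewrite /D (Xindep [set: edge n]%SET (A := fun e => cell M (k e))); last first.
    by move=> e; apply: measurable_cell.
  by rewrite -prodEFin; apply: eq_big => [e|e _]; rewrite ?inE // -pE.
have mA : measurable (\bigcup_(k in [set k | good k]) D k).
  by apply: fin_bigcup_measurable; first exact: finite_finset.
exists (\bigcup_(k in [set k | good k]) D k); split=> //.
- apply: le_trans (measure_union_bound (Q := good) P mA mD _) _.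
    by move=> t [k gk Dk]; exists k.
  under eq_bigr do rewrite PD; rewrite sumEFin lee_fin.
  apply: le_trans (prod_prob_triangular p_ge0 p_sum (fun=> M%:R) p_le H0 nz pw) _.
  have phiM : 0 <= phi / M%:R by rewrite divr_ge0 // ltW.
  apply: lerXn2r; rewrite ?nnegrE.
  - by rewrite mulr_ge0 // addr_ge0 // mulr_ge0.
  - by rewrite !mulr_ge0 // ltW.
  rewrite [4 * phi]mulrC -[leRHS]mulrA mulrCA ler_pM2l // ler_pdivrMr //.
  have := MP; rewrite ltr_pdivrMr ?mulr_gt0 // /H; lra.
- move=> t X1 small.
  have /fin_all_exists[k hk] e : exists k : 'I_N.+1, cell M k (X e t).
    exact: cell_cover.
  exists [ffun e => k e]; last by move=> e _; rewrite /C /= ffunE.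
  apply/allP => q qL; apply: (@le_trans _ _ (`|M%:R * \sum_e X e t * (q.1 e)%:~R| +
     \sum_e `|(q.1 e)%:~R|)).
    apply: (@le_trans _ _ (`|M%:R * \sum_e X e t * (q.1 e)%:~R +
        \sum_e ((k e)%:R - M%:R * (X e t + 1)) * (q.1 e)%:~R|)).
      rewrite mulr_sumr -big_split /=; under eq_bigr do rewrite ffunE.
      by rewrite le_eqVlt; apply/orP; left; apply/eqP; congr (`|_|); apply: eq_bigr => e _; ring.
    apply: le_trans (ler_normD _ _) _; rewrite lerD2l.
    apply: le_trans (ler_norm_sum _ _ _) _; apply: ler_sum => e _.
    rewrite normrM ler_piMl // ler_norml.
    by have /(cellP _ _ M0)/andP[h1 h2] := hk e; rewrite -natr1 in h2; apply/andP; split; lra.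
  rewrite /H lerD //.
    by rewrite normrM gtr0_norm // ler_pM2l // ltW // small.
  by rewrite /S (big_rem q) //= lerDl sumr_ge0 // => r _; apply: sumr_ge0.
Qed.

Lemma measurable_cut_value (s : cut3 n) :
  measurable_fun setT (fun t => cut_value (fun e => X e t) s).
Proof.
rewrite /cut_value.
under eq_fun do rewrite big_mkcond.
by apply: measurable_sum => e; case: crosses.
Qed.

(** Termination depends on the weights only through the comparisons between values of cuts. There
    are finitely many comparison patterns, each of which is a measurable event. *)
Lemma measurable_flip (B : R) :
  measurable [set t | flip_terminates_within (fun e => X e t) B].
Proof.
pose cmp t : {ffun cut3 n * cut3 n -> bool} :=
  [ffun p => cut_value (fun e => X e t) p.1 < cut_value (fun e => X e t) p.2].
have same t t' : cmp t = cmp t' -> flip_terminates_within (fun e => X e t) B ->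
    flip_terminates_within (fun e => X e t') B.
  move=> /ffunP E h c exc.
  have step s s' : flip_step (fun e => X e t) s s' <-> flip_step (fun e => X e t') s s'.
    by split=> -[x [q [h1 h2 h3]]]; exists x, q; split=> //; have := E (s, s');
      rewrite !ffunE /= h3.
  have lo s : local_opt (fun e => X e t) s <-> local_opt (fun e => X e t') s.
    by split=> h1 s' /step /h1.
  have [|k kB /lo] := h c; last by exists k.
  by move=> k; case: (exc k) => [/step|[/lo ? ?]]; [left|right].
pose Q (r : {ffun cut3 n * cut3 n -> bool}) :=
  exists2 t, cmp t = r & flip_terminates_within (fun e => X e t) B.
rewrite (_ : [set t | _] = \bigcup_(r in Q) [set t | cmp t = r]); last first.
  apply/seteqP; split=> [t ht|t [r [t' <- ht']] /= /esym /same]; last exact.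
  by exists (cmp t) => //; exists t.
apply: fin_bigcup_measurable => [|r _]; first exact: finite_finset.
rewrite (_ : [set t | _] = \bigcap_(p in [set: cut3 n * cut3 n])
  ((fun t => cut_value (fun e => X e t) p.1 < cut_value (fun e => X e t) p.2) @^-1` [set r p])).
  apply: fin_bigcap_measurable => [|p _]; first exact: finite_finset.
  rewrite -[X in measurable X]setTI.
  by apply: measurable_fun_ltr => //; apply: measurable_cut_value.
apply/seteqP; split=> [t /= <- p _ /=|t h]; first by rewrite ffunE.
by apply/ffunP => p; rewrite ffunE; apply: h.
Qed.

End Weights.

(** * Union bound *)

Lemma sum_geometric_le2 (R : realType) (q : R) (n : nat) : 0 <= q -> q <= 2^-1 ->
  \sum_(s < n) q ^+ s <= 2.
Proof.
move=> q0 q2; elim: n => [|n IH]; first by rewrite big_ord0.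
rewrite big_ord_recl expr0 /=; under eq_bigr do rewrite exprS.
rewrite -mulr_sumr; have : q * \sum_(s < n) q ^+ s <= 2^-1 * 2.
  by rewrite ler_pM // sumr_ge0 // => s _; rewrite exprn_ge0.
lra.
Qed.

Section UnionBound.
Variables (R : realType) (n : nat) (d : measure_display) (T : measurableType d).
Variables (P : probability T R) (X : edge n -> {RV P >-> R}) (f : edge n -> R -> R).
Variable phi : R.
Hypothesis phi_gt0 : 0 < phi.
Hypothesis Xindep : mutually_independent X.
Hypothesis Xf : forall e, has_density_on_pm1 (X e) (f e).
Hypothesis f_le : forall e x, x \in `[-1, 1] -> f e x <= phi.

(** Here [z] is the probability factor per moved vertex: with [s] moved vertices there are at least
    [s / 24] forms, all small with probability at most [z ^ s], against [(9 n)^(4 s)] codes. *)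
Lemma bad_event (z eps : R) : (0 < n)%N -> 0 < z -> z <= 1 -> 4 * phi * eps = z ^+ 24 ->
  exists A : set T, [/\ measurable A,
    (P A <= (\sum_(s < n) ((9 * n%:R) ^+ 4 * z) ^+ s.+1)%:E)%E
  & forall t, (forall e, `|X e t| <= 1) -> ~ A t ->
      forall c, (forall i, (i < 4 * n)%N -> flip_step (fun e => X e t) (c i) (c i.+1)) ->
      cut_value (fun e => X e t) (c 0%N) + eps <= cut_value (fun e => X e t) (c (4 * n)%N)].
Proof.
move=> n0 z0 z1 epsz.
have eps0 : 0 < eps.
  by have := exprn_gt0 24 z0; rewrite -epsz pmulr_rgt0 // mulr_gt0.
pose L s (ms : {ffun 'I_(4 * s) -> 'I_n * 'I_3 * 'I_3}) := s2val (cid2 (@moves_family R n _ ms)).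
have LP s ms : triangular (L s ms) by rewrite /L; case: cid2.
have famL s (ms : {ffun 'I_(4 * s) -> 'I_n * 'I_3 * 'I_3}) (w : edge n -> R) v c :
    realizes ms v c -> critical (4 * s) v ->
    (forall t, (t < 4 * s)%N -> 0 < \sum_e w e * (move_delta c t e)%:~R) ->
    (4 * s <= 96 * size (L s ms))%N /\
    forall p, p \in L s ms -> `|\sum_e w e * (p.1 e)%:~R| <=
       \sum_(0 <= t < 4 * s) \sum_e w e * (move_delta c t e)%:~R.
  by rewrite /L; case: cid2 => /= l _; apply.
have one s (ms : {ffun 'I_(4 * s) -> 'I_n * 'I_3 * 'I_3}) : exists A : set T,
    [/\ measurable A, (P A <= (z ^+ s)%:E)%E &
      forall t, (forall e, `|X e t| <= 1) -> (s <= 24 * size (L s ms))%N ->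
       (forall p, p \in L s ms -> `|\sum_e X e t * (p.1 e)%:~R| < eps) -> A t].
  case: (leqP s (24 * size (L s ms))) => hs; last first.
    exists set0; split=> //; first by rewrite measure0 lee_fin exprn_ge0 // ltW.
  have [A [mA PA hA]] := forms_prob phi_gt0 Xindep Xf f_le (LP s ms) eps0.
  exists A; split=> // [|t X1 _]; last exact: hA.
  apply: (le_trans PA); rewrite lee_fin epsz -exprM.
  by apply: ler_wiXn2l => //; rewrite ltW.
(* The index [s] stands for [s.+1] moved vertices. *)
have level (s : 'I_n) : exists A : set T,
    [/\ measurable A, (P A <= (((9 * n%:R) ^+ 4 * z) ^+ s.+1)%:E)%E &
      forall t (ms : {ffun 'I_(4 * s.+1) -> 'I_n * 'I_3 * 'I_3}),
       (forall e, `|X e t| <= 1) -> (s.+1 <= 24 * size (L s.+1 ms))%N ->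
       (forall p, p \in L s.+1 ms -> `|\sum_e X e t * (p.1 e)%:~R| < eps) -> A t].
  have /fin_all_exists[A hA] := one s.+1.
  have mA ms : measurable (A ms) by have [] := hA ms.
  have mU : measurable (\bigcup_ms A ms).
    by apply: fin_bigcup_measurable; first exact: finite_finset.
  exists (\bigcup_ms A ms); split=> // [|t ms X1 h1 h2]; last first.
    by exists ms => //; have [_ _] := hA ms; apply.
  apply: le_trans (measure_union_bound (Q := predT) P mU mA _) _.
    by move=> t [ms _ h]; exists ms.
  apply: (@le_trans _ _ (\sum_(ms : {ffun 'I_(4 * s.+1) -> 'I_n * 'I_3 * 'I_3})
     (z ^+ s.+1)%:E)%E).
    by apply: lee_sum => ms _; have [] := hA ms.
  rewrite sumEFin lee_fin sumr_const card_ffun !card_prod !card_ord.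
  rewrite -[_ *+ _]mulr_natl exprMn -exprM natrX.
  by rewrite -mulnA [(n * _)%N]mulnC natrM.
have /fin_all_exists[A hA] := level.
have mA s : measurable (A s) by have [] := hA s.
have mU : measurable (\bigcup_s A s).
  by apply: fin_bigcup_measurable; first exact: finite_finset.
exists (\bigcup_s A s); split=> // [|t X1 nA c flips].
  apply: le_trans (measure_union_bound (Q := predT) P mU mA _) _.
    by move=> t [s _ h]; exists s.
  by rewrite -sumEFin; apply: lee_sum => s _; have [] := hA s.
apply: (flip_gain (L := L)) => // [s ms v c'|[//|s] ms /andP[_ sn] sL]; first exact: famL.
apply: contrapT => h; apply: nA; exists (Ordinal sn) => //.
have [_ _] := hA (Ordinal sn); apply; [exact: X1|exact: sL|].
by move=> p pL; rewrite ltNge; apply/negP => hp; apply: h; exists p.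
Qed.

Lemma flip_prob (q B : R) (K : nat) : (1 < n)%N -> 0 < q -> q <= 2^-1 ->
  n%:R ^+ 2 * (4 * phi * (9 * n%:R) ^+ 96) < K%:R * q ^+ 24 -> (4 * n * K)%:R <= B ->
  ((1 - 2 * q)%:E <=
    P [set t | flip_terminates_within (fun e => X e t) B])%E.
Proof.
move=> n1 q0 q2 hK hB; have n0 : (0 < n)%N := ltnW n1.
have N0 : (0 : R) < 9 * n%:R by rewrite mulr_gt0 // ltr0n.
have N1 : (1 : R) <= 9 * n%:R by rewrite -natrM ler1n muln_gt0.
have N40 : (0 : R) < (9 * n%:R) ^+ 4 by rewrite exprn_gt0.
(* With this choice the term for [s] moved vertices is [q ^ s], and the geometric sum is at most
   [2 * q]. *)
pose z := q / (9 * n%:R) ^+ 4; have z0 : 0 < z by rewrite divr_gt0.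
have z1 : z <= 1.
  rewrite ler_pdivrMr // mul1r (@le_trans _ _ 1) ?exprn_ege1 //; lra.
pose eps := z ^+ 24 / (4 * phi).
have p40 : 0 < 4 * phi by rewrite mulr_gt0.
have epsz : 4 * phi * eps = z ^+ 24 by rewrite mulrC divfK // gt_eqF.
have [A [mA PA hA]] := bad_event n0 z0 z1 epsz.
set G := [set t | _]; have mG : measurable G by apply: measurable_flip.
(* The events that a weight falls outside [[-1, 1]] are null and join the exceptional set. *)
pose I e := ~` (X e @^-1` [set` `[-1, 1]]).
have mI e : measurable (I e).
  by apply: measurableC; apply: measurable_funPTI; apply: measurable_itv.
have mU : measurable (\bigcup_e I e).
  by apply: fin_bigcup_measurable; first exact: finite_finset.
have PU : (P (\bigcup_e I e) <= 0)%E.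
  apply: le_trans (measure_union_bound (Q := predT) P mU mI _) _.
    by move=> t [e _ h]; exists e.
  rewrite big1 // => e _; rewrite probability_setC; last first.
    by apply: measurable_funPTI; apply: measurable_itv.
  by rewrite (density_support (Xf e)) subee.
have sub : ~` G `<=` A `|` \bigcup_e I e.
  move=> t nG; apply: contrapT => /not_orP[nA nI]; apply: nG.
  have X1 e : `|X e t| <= 1.
    case: (boolP (`|X e t| <= 1)) => // /negP h; case: nI; exists e => //.
    by move=> Xe; apply: h; rewrite ler_norml; move: Xe; rewrite /= in_itv.
  apply: (flip_terminates (hA t X1 nA) X1 _ hB).
  have -> : K%:R * eps = K%:R * q ^+ 24 / (4 * phi * (9 * n%:R) ^+ 96).
    rewrite /eps /z expr_div_n -exprM; move: (4 * phi) (_ ^+ (4 * 24)) (q ^+ 24) => a y r.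
    by rewrite invfM !mulrA mulrAC.
  by rewrite ltr_pdivlMr // mulr_gt0 // exprn_gt0.
have PG : (P (~` G) <= (2 * q)%:E)%E.
  apply: (@le_trans _ _ (P (A `|` \bigcup_e I e))).
    by apply: le_measure; rewrite ?inE //; [exact: measurableC|exact: measurableU].
  apply: (le_trans (@measureU2 _ _ _ P _ _ mA mU)).
  rewrite -[leRHS]adde0; apply: leeD => //; apply: (le_trans PA); rewrite lee_fin.
  rewrite /z mulrCA mulfV ?gt_eqF // mulr1; under eq_bigr do rewrite exprS.
  rewrite -mulr_sumr mulrC ler_wpM2r ?(ltW q0) //.
  exact: sum_geometric_le2 (ltW q0) q2.
move: PG; rewrite probability_setC // -(fineK (fin_num_measure P _ mG)) -EFinB !lee_fin.
lra.
Qed.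

(** All the mass of a weight lies in [[-1, 2)], of length 3. The resulting lower bound on [phi] lets
    terms free of [phi] be absorbed into the final bound. *)
Lemma density_bound_ge : (1 < n)%N -> 1 <= 3 * phi.
Proof.
move=> n1; have [e _] : exists e : edge n, Ordinal (ltnW n1) \in val e /\ Ordinal n1 \in val e.
  by apply: edge_pair.
rewrite -lee_fin -(density_support (Xf e)).
apply: (@le_trans _ _ (P (X e @^-1` [set` `[-1, 2[]))).
  apply: le_measure; rewrite ?inE; try by apply: measurable_funPTI; apply: measurable_itv.
  move=> t; rewrite /= !in_itv /= => /andP[-> h] /=; lra.
apply: le_trans (density_interval (Xf e) (f_le e) _) _; first by lra.
rewrite lee_fin; lra.
Qed.

End UnionBound.

(** * Choice of the constants *)

Lemma natr_powRN_cvg0 (R : realType) (a : R) : 0 < a ->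
  (2 * n%:R `^ (- a)) @[n --> \oo] --> (0 : R).
Proof.
move=> a0; apply/cvgrPdist_lt => e e0; near=> n.
have n0 : (0 : R) < n%:R by rewrite ltr0n; near: n; apply: nbhs_infty_gt.
have e20 : 0 < 2 / e by rewrite divr_gt0.
have h : 2 / e < n%:R `^ a.
  have -> : 2 / e = ((2 / e) `^ a^-1) `^ a by rewrite -powRrM mulVf ?gt_eqF // powRr1 // ltW.
  apply: gt0_ltr_powR => //; rewrite ?nnegrE ?powR_ge0 // ?ltW //.
  by near: n; apply: nbhs_infty_gtr.
rewrite sub0r normrN powRN ger0_norm ?mulr_ge0 ?invr_ge0 ?powR_ge0 //.
rewrite ltr_pdivrMr ?powR_gt0 // mulrC -ltr_pdivrMr //.
Unshelve. all: by end_near.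
Qed.

Theorem theorem1p2 (R : realType) (eta : R) (eta_gt0 : 0 < eta) :
  exists (C : R) (delta : nat -> R),
    delta n @[n --> \oo] --> (0 : R) /\
    forall (n : nat) (phi : R) (d : measure_display) (T : measurableType d)
      (P : probability T R) (X : edge n -> {RV P >-> R}) (f : edge n -> R -> R),
      0 < phi ->
      mutually_independent X ->
      (forall e, has_density_on_pm1 (X e) (f e)) ->
      (forall e x, x \in `[-1, 1] -> f e x <= phi) ->
      ((1 - delta n)%:E <=
        P [set omega | flip_terminates_within (fun e => X e omega)
                         (C * phi * n%:R `^ (99 + eta))])%E.
Proof.
(* The failure probability is at most [2 * q] with [q = n^(-eta/24)]; for [n < 2] the value 1 makes
   the claim trivial. In the constant, [16 * 9 ^+ 96] comes from [4 * n * u] and 12 from rounding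
   [u] up to [K]. *)
exists (16 * 9 ^+ 96 + 12), (fun n => if (n < 2)%N then 1 else 2 * n%:R `^ (- (eta / 24))).
split.
  apply: (@cvg_trans _ ((2 * n%:R `^ (- (eta / 24)) : R) @[n --> \oo])); last first.
    by apply: natr_powRN_cvg0; rewrite divr_gt0.
  by apply: near_eq_cvg; near=> n; rewrite ltnNge; have -> : (1 < n)%N by near: n; apply: nbhs_infty_gt.
move=> n phi d T P X f phi0 indep Xf f_le.
case: ltnP => [_|n1]; first by rewrite subrr; apply: measure_ge0.
(* For [q] above one half the claimed lower bound is negative. *)
set q := n%:R `^ _; case: (leP q 2^-1) => [q2|q2]; last first.
  by apply: (@le_trans _ _ 0%E); [rewrite lee_fin; lra|apply: measure_ge0].
have N1 : (1 : R) <= n%:R by rewrite ler1n ltnW.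
have N0 : (0 : R) < n%:R by lra.
have q0 : 0 < q by apply: powR_gt0.
pose x : R := n%:R `^ eta.
have x1 : 1 <= x by rewrite -(powRr0 n%:R) ler_powR // ltW.
have x0 : 0 < x by lra.
have qx : q ^+ 24 = x^-1.
  rewrite /q -powR_mulrn ?powR_ge0 // -powRrM -powRN; congr (_ `^ _); lra.
have phi3 : 1 <= 3 * phi := density_bound_ge Xf f_le n1.
pose c : R := 9 ^+ 96; have c0 : 0 < c by rewrite exprn_gt0.
(* This is [n^2 / eps] for the [eps] chosen in [flip_prob], so more than [u] windows are enough. *)
pose u : R := n%:R ^+ 2 * (4 * phi * (9 * n%:R) ^+ 96) * x.
have hK := truncnS_gt u; set K := (Num.trunc u).+1 in hK.
apply: (@flip_prob R n d T P X f phi phi0 indep Xf f_le q _ K) => //.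
  by rewrite qx ltr_pdivlMr.
have u0 : 0 <= u by rewrite /u !mulr_ge0 ?exprn_ge0 ?mulr_ge0 // ltW.
have Ku : K%:R <= u + 1.
  by rewrite /K -natr1 lerD2r truncn_le.
rewrite !natrM; apply: (@le_trans _ _ (4 * n%:R * (u + 1))).
  by rewrite ler_wpM2l // mulr_ge0 // ltW.
have -> : n%:R `^ (99 + eta) = n%:R ^+ 99 * x.
  rewrite powRD; last by rewrite (gt_eqF N0) implybT.
  by rewrite -powR_mulrn // ltW.
have -> : 4 * n%:R * (u + 1) = 16 * c * phi * (n%:R ^+ 99 * x) + 4 * n%:R.
  rewrite /u exprMn -/c (_ : 99 = 1 + 2 + 96)%N // !exprD expr1.
  by move: (n%:R ^+ 96) (n%:R ^+ 2) => y1 y2; ring.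
rewrite -/c [leRHS](_ : _ = 16 * c * phi * (n%:R ^+ 99 * x) + 12 * phi * (n%:R ^+ 99 * x));
  last by rewrite !mulrDl.
rewrite lerD2l.
(* The rounding error [4 * n] is covered because [4 <= 12 * phi]. *)
have n99 : (n%:R : R) <= n%:R ^+ 99 * x.
  rewrite exprS -mulrA ler_peMr // ?(ltW N0) // mulr_ege1 // exprn_ege1 //.
apply: (@le_trans _ _ (4 * (n%:R ^+ 99 * x))); first by rewrite ler_pM2l.
rewrite ler_wpM2r //; last by lra.
by rewrite mulr_ge0 ?exprn_ge0 // ltW.
Unshelve. all: by end_near.
Qed.
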